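(* Fix $0<r<1$, and let $\frac{d\mu_{P_\lambda^{QW}}}{dx}$ denote the density of the absolutely continuous part of $\mu_{P_\lambda^{QW}}$, which lives on $[S_-,S_+]$ with $S_\pm=\lambda+\omega\pm2\sqrt{\lambda\omega}$. Then: (1) For any $\lambda>0$, $\displaystyle\lim_{x\uparrow S_+}\left(\frac{d\mu_{P_\lambda^{QW}}}{dx}\right)'(x)=-\infty$. (2) If $\lambda=\Lambda_-(r)$ or $\lambda=\omega$, then $\displaystyle\lim_{x\downarrow S_-}\left(\frac{d\mu_{P_\lambda^{QW}}}{dx}\right)'(x)=-\infty$. (3) If $\lambda\ne\Lambda_-(r)$ and $\lambda\ne\omega$, then $\displaystyle\lim_{x\downarrow S_-}\left(\frac{d\mu_{P_\lambda^{QW}}}{dx}\right)'(x)=+\infty$. Moreover, $\lambda=\Lambda_-(r)$ and $\lambda=\omega$ are precisely the transition points for the edge behavior of the density at the left endpoint $S_-$: for every $\lambda>0$ there is a constant $C_\lambda>0$ with $$\frac{d\mu_{P_\lambda^{QW}}}{dx}(x)\sim C_\lambda(x-S_-)^{\kappa(\lambda)}\qquad(x\downarrow S_-),$$ where $\kappa(\lambda)=\frac12$ if $\lambda\ne\Lambda_-(r)$ and $\lambda\ne\omega$, and $\kappa(\lambda)=-\frac12$ if $\lambda=\Lambda_-(r)$ or $\lambda=\omega$.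
   Context: Fix $r\in(0,1)$ and let $\omega_1=1-\sqrt{1-r^2}$, $\omega_2=\frac{\sqrt{1-r^2}}{2}\omega_1$, $\omega=\frac{r^2}{4}$, and $\omega_n=\omega$ for $n\ge3$. Let $\mathcal H$ be a complex Hilbert space with complete orthonormal system $\{\Phi_n\}_{n\ge0}$, and let $B_+^{QW},B_-^{QW}$ be the bounded operators with $B_+^{QW}\Phi_n=\sqrt{\omega_{n+1}}\,\Phi_{n+1}$ ($n\ge0$), $B_-^{QW}\Phi_n=\sqrt{\omega_n}\,\Phi_{n-1}$ ($n\ge1$), $B_-^{QW}\Phi_0=0$; they are mutually adjoint. For $\lambda>0$ put $P_\lambda^{QW}=(B_+^{QW}+\sqrt\lambda I)(B_-^{QW}+\sqrt\lambda I)$. Its spectral distribution is $\mu_{P_\lambda^{QW}}(B)=\langle\Phi_0,E(B)\Phi_0\rangle$, with $E$ the spectral measure of $P_\lambda^{QW}$. With $t=\sqrt{1-r^2}$, $\Lambda_-(r)=\left(\frac{r(1-t)(3-t)}{4(t^2-t+2)}\right)^2$. The density is taken in its continuous version on the open interval $(S_-,S_+)$, and $'$ is the derivative in $x$. $f\sim g$ means $f/g\to1$. *)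

(* Defs.v *)
From HB Require Import structures.
From mathcomp Require Import all_boot all_order all_algebra.
From mathcomp Require Import complex.
From mathcomp Require Import all_classical all_reals all_analysis.

Set Implicit Arguments.
Unset Strict Implicit.
Unset Printing Implicit Defensive.

Import Order.TTheory GRing.Theory Num.Theory.
Import numFieldNormedType.Exports.

Local Open Scope classical_set_scope.
Local Open Scope ring_scope.
Local Open Scope complex_scope.

(* The form [inner] is linear in its first argument
   and conjugate-linear in its second one; the norm of a normed module over
   [R[i]] takes its values in [R[i]]. *)
HB.mixin Record CompleteNormedModule_hasInner (R : realType) H
    of CompleteNormedModule R[i] H := {
  inner : {dot H for Num.conj} ;
  inner_norm : forall x : H, inner x x = `|x| ^+ 2
}.

#[short(type="hilbertType")]
HB.structure Definition Hilbert (R : realType) :=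
  {H of CompleteNormedModule_hasInner R H & CompleteNormedModule R[i] H}.

Definition orthonormal_system (R : realType) (H : hilbertType R)
    (Phi : nat -> H) : Prop :=
  forall m n : nat, inner (Phi m) (Phi n) = (m == n)%:R.

Definition complete_system (R : realType) (H : hilbertType R)
    (Phi : nat -> H) : Prop :=
  forall x : H, (forall n : nat, inner x (Phi n) = 0) -> x = 0.

Definition orthogonal_projection (R : realType) (H : hilbertType R)
    (p : {linear H -> H}) : Prop :=
  (forall x : H, p (p x) = p x) /\
  (forall x y : H, inner (p x) y = inner x (p y)).

(* Projection-valued measures on the Borel sets of the line. Nothing is asked
   of [pvm_proj] on sets that are not Borel. *)
Record pvm (R : realType) (H : hilbertType R) := Pvm {
  pvm_proj :> set R -> {linear H -> H} ;
  pvm_projection : forall B : set R, measurable B ->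
    orthogonal_projection (pvm_proj B) ;
  pvm_set0 : forall x : H, pvm_proj set0 x = 0 ;
  pvm_setT : forall x : H, pvm_proj setT x = x ;
  pvm_setI : forall A B : set R, measurable A -> measurable B ->
    forall x : H, pvm_proj (A `&` B) x = pvm_proj A (pvm_proj B x) ;
  pvm_sigma_additive : forall F : (set R)^nat,
    (forall k, measurable (F k)) -> trivIset setT F ->
    forall x : H, (\sum_(0 <= k < n) pvm_proj (F k) x) @[n --> \oo] -->
      pvm_proj (\bigcup_k F k) x
}.

(* B |-> <x, E(B) x>, which is real; the value 0 outside the Borel sets is a
   convention, since measures are total functions on [set R]. *)
Definition pvm_measure (R : realType) (H : hilbertType R) (E : pvm H) (x : H)
    (B : set R) : \bar R :=
  if `[< measurable B >] then (complex.Re (inner x (E B x)))%:E else 0%E.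

Section pvm_measure_lemmas.
Variables (R : realType) (H : hilbertType R) (E : pvm H) (x : H).

Lemma inner_pvm (B : set R) : measurable B ->
  inner x (E B x) = `|E B x| ^+ 2.
Proof.
move=> mB; have [idE saE] := pvm_projection E mB.
by rewrite -inner_norm saE idE.
Qed.

Lemma complex_Re_ge0 (z : R[i]) : 0 <= z -> 0 <= complex.Re z.
Proof. by rewrite lecE => /andP[]. Qed.

Lemma pvm_measure0 : pvm_measure E x set0 = 0%E.
Proof. by rewrite /pvm_measure pvm_set0 linear0r; case: ifP. Qed.

Lemma pvm_measure_ge0 (B : set R) : (0 <= pvm_measure E x B)%E.
Proof.
rewrite /pvm_measure; case: ifPn => [/asboolP mB|_ //].
by rewrite lee_fin complex_Re_ge0 // inner_pvm// exprn_ge0.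
Qed.

Lemma pvm_partial_sum (F : (set R)^nat) (n : nat) :
  (forall k, measurable (F k)) -> trivIset setT F ->
  `|\sum_(0 <= k < n) E (F k) x| ^+ 2 =
  \sum_(0 <= k < n) inner x (E (F k) x).
Proof.
move=> mF tF; rewrite -inner_norm.
rewrite linear_sumr /=; apply: eq_big_nat => k /andP[_ kn].
have [idE saE] := pvm_projection E (mF k).
rewrite -saE linear_sum /= (bigD1_seq k) ?mem_index_iota ?iota_uniq //=.
rewrite big1 => [|j jk]; last first.
  rewrite -pvm_setI//; move/trivIsetP: tF => /(_ k j Logic.I Logic.I).
  by rewrite eq_sym => /(_ jk) ->; rewrite pvm_set0.
by rewrite addr0 idE saE.
Qed.

Lemma pvm_measure_semi_sigma_additive :
  semi_sigma_additive (pvm_measure E x).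
Proof.
move=> F mF tF mUF.
have mE k : pvm_measure E x (F k) = (complex.Re (inner x (E (F k) x)))%:E.
  by rewrite /pvm_measure; case: ifPn => // /asboolP.
rewrite [in X in _ --> X]/pvm_measure asboolT //.
under eq_fun do (under eq_bigr do rewrite mE; rewrite sumEFin).
apply: cvg_EFin; first exact: nearW.
rewrite inner_pvm //.
set S := fun n => \sum_(0 <= k < n) E (F k) x.
have -> : fine \o (fun n => (\sum_(0 <= k < n)
    complex.Re (inner x (E (F k) x)))%:E) =
    fun n => complex.Re (`|S n| ^+ 2).
  apply/funext => n /=; rewrite /S pvm_partial_sum//.
  by rewrite (raddf_sum (@complex.Re R : Rcomplex R -> R)).
have /cvg_norm SE : S @ \oo --> E (\bigcup_k F k) x.
  exact: pvm_sigma_additive.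
have SE2 : (fun n => `|S n| * `|S n|) @ \oo -->
    `|E (\bigcup_k F k) x| * `|E (\bigcup_k F k) x|.
  by apply: cvgM; exact: SE.
apply/cvgrPdist_lt => e e0.
have e0' : (0 : R[i]) < e%:C by rewrite ltcR.
move/cvgrPdist_lt : SE2 => /(_ _ e0'); apply: filterS => n /=.
rewrite -!expr2 => h; rewrite -ltcR; apply: le_lt_trans h.
by rewrite -(raddfB (@complex.Re R : Rcomplex R -> R)) normc_ge_Re.
Qed.

HB.instance Definition _ := isMeasure.Build _ _ _ (pvm_measure E x)
  pvm_measure0 pvm_measure_ge0 pvm_measure_semi_sigma_additive.

End pvm_measure_lemmas.

(* E is the spectral measure of the bounded operator A when E has bounded
   support and A = \int t dE(t), i.e. <A x, x> = \int t d<x, E(t) x> for every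
   x (by polarization, the quadratic form determines the operator). *)
Definition is_spectral_measure (R : realType) (H : hilbertType R)
    (E : pvm H) (A : H -> H) : Prop :=
  (exists a : R, forall x : H, E `[- a, a]%classic x = x) /\
  (forall x : H,
     inner (A x) x = (\int[pvm_measure E x]_t t)%:C).

Definition mutually_singular (R : realType) (nu1 nu2 : set R -> \bar R) : Prop :=
  exists N : set R, [/\ measurable N, nu1 N = 0%E & nu2 (~` N) = 0%E].

(* f is a density of the absolutely continuous part in the Lebesgue
   decomposition of mu. *)
Definition is_ac_density (R : realType) (mu : {measure set R -> \bar R})
    (f : R -> R) : Prop :=
  [/\ measurable_fun setT f,
      (forall x, 0 <= f x) &
      exists nu : {measure set R -> \bar R},
        mutually_singular (@lebesgue_measure R) nu /\
        forall B : set R, measurable B ->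
          mu B = (\int[@lebesgue_measure R]_(x in B) (f x)%:E + nu B)%E].

Section quantum_walk.
Variables (R : realType) (r : R).

Definition qw_t : R := Num.sqrt (1 - r ^+ 2).

Definition qw_w : R := r ^+ 2 / 4.

(* The coefficients are indexed from 1; the value at 0 is never used. *)
Definition qw_omega (n : nat) : R :=
  match n with
  | 0 => 0
  | 1 => 1 - qw_t
  | 2 => qw_t / 2 * (1 - qw_t)
  | _ => qw_w
  end.

Definition qw_Lambda : R :=
  (r * (1 - qw_t) * (3 - qw_t) / (4 * (qw_t ^+ 2 - qw_t + 2))) ^+ 2.

Definition qw_Sminus (lam : R) : R := lam + qw_w - 2 * Num.sqrt (lam * qw_w).

Definition qw_Splus (lam : R) : R := lam + qw_w + 2 * Num.sqrt (lam * qw_w).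

Definition qw_kappa (lam : R) : R :=
  if (lam == qw_Lambda) || (lam == qw_w) then - 2^-1 else 2^-1.

End quantum_walk.

Definition is_qw_creation (R : realType) (H : hilbertType R) (r : R)
    (Phi : nat -> H) (B : {linear H -> H}) : Prop :=
  continuous B /\
  forall n : nat, B (Phi n) = (Num.sqrt (qw_omega r n.+1))%:C *: Phi n.+1.

Definition is_qw_annihilation (R : realType) (H : hilbertType R) (r : R)
    (Phi : nat -> H) (B : {linear H -> H}) : Prop :=
  [/\ continuous B,
      B (Phi 0%N) = 0 &
      forall n : nat, B (Phi n.+1) = (Num.sqrt (qw_omega r n.+1))%:C *: Phi n].

Definition qw_P (R : realType) (H : hilbertType R) (Bp Bm : H -> H) (lam : R)
    (x : H) : H :=
  let s := (Num.sqrt lam)%:C in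
  let y := Bm x + s *: x in
  Bp y + s *: y.

Definition is_qw_density (R : realType) (r lam : R)
    (mu : {measure set R -> \bar R}) (f : R -> R) : Prop :=
  is_ac_density mu f /\
  {in `]qw_Sminus r lam, qw_Splus r lam[, continuous f}.

(* Main.v *)
Require Import Defs.
From HB Require Import structures.
From mathcomp Require Import all_boot all_order all_algebra.
From mathcomp Require Import complex.
From mathcomp Require Import ring lra.
From mathcomp Require polyrcf.
From mathcomp Require Import all_classical all_reals all_analysis measurable_realfun.
Import Order.TTheory GRing.Theory Num.Theory.
Import numFieldNormedType.Exports.

(** Put [s = sqrt lambda] and [g = sqrt omega = r / 2]. In the basis [Phi] the
    operator [P = (B+ + s) (B- + s)] is a Jacobi matrix whose coefficients are
    eventually constant, with diagonal [a = s^2 + g^2] and off-diagonal [s g].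
    Write [z = a + s g (q + 1/q)] with [|q| < 1]. The equation
    [(P - z) v = c Phi_0] then has a solution that is a geometric sequence of
    ratio [q] from index two on ([jacobi_resolvent_vector]), and the Green
    function [<(P - z)^-1 Phi_0, Phi_0>] is [- q N(q) / D(q)] for two explicit
    polynomials [N] and [D].

    For an arbitrary projection-valued measure with [<P x, x> = \int t dmu_x],
    polarization shows that the projections commute with [P] and that
    [(P - z) v = phi] makes [mu_phi] the measure of density [|t - z|^2] with
    respect to [mu_v] ([spectral_resolvent]). Hence the Poisson integral of the
    spectral distribution at [x + i e] is the imaginary part of the Green
    function ([poisson_int_jacobi]).

    When [z] tends to a real [x] inside [(S_-, S_+)], the parameter [q] tends to
    the point of the lower unit half-circle with real part [c = (x - a) / (2 s g)];
    when [x] is outside [[S_-, S_+]], it tends to a real number. The Poisson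
    integrals converge locally uniformly, except at finitely many points, to the
    imaginary part of the boundary value ([poisson_int_spectral_density]).
    By Stieltjes inversion ([stieltjes_inversion]) the spectral distribution has
    the limit divided by [pi] as density off these points, which carry the
    singular part.

    A Wronskian identity ([jacobi_wronskian]) evaluates the imaginary part on
    the unit circle, and gives the density
    [k sqrt(1 - c^2) / (pi |D|^2)] with a constant [k > 0], where [|D|^2] is a
    polynomial in [c], positive on [(-1, 1)]. Moreover [D] is, up to a constant,
    the product of [s + g q] and of a quartic [Q]. Neither factor vanishes at
    [q = 1]. At [q = -1] the first one vanishes if and only if
    [lambda = omega], the second one if and only if [lambda = Lambda_-], and the
    zero is simple in both cases ([qw_density_den_root_left]). So the density
    behaves at [S_-] like the square root of [x - S_-], or like its inverse at
    the two transition points; the limits of the derivative are read off from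
    the quotient rule. Finally two densities agree almost everywhere, so that a
    density that is continuous on [(S_-, S_+)] is the one above there
    ([ae_eq_continuous]). *)

Set Implicit Arguments.
Unset Strict Implicit.
Unset Printing Implicit Defensive.

Local Open Scope classical_set_scope.
Local Open Scope ring_scope.
Local Open Scope complex_scope.

(** * The real part of the inner product *)

Section rdot.
Context (R : realType) (H : hilbertType R).
Implicit Types x y : H.

Definition rdot x y : R := complex.Re (inner x y).

Lemma innerC x y : inner x y = (inner y x)^*.
Proof. by rewrite hermC expr0 mul1r. Qed.

Lemma rdotC x y : rdot x y = rdot y x.
Proof. by rewrite /rdot innerC; case: (inner y x). Qed.

Lemma rdotDl x y z : rdot (x + y) z = rdot x z + rdot y z.
Proof. by rewrite /rdot linearDl/=; case: (inner x z) (inner y z) => ? ? []. Qed.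

Lemma rdotNl x y : rdot (- x) y = - rdot x y.
Proof. by rewrite /rdot linearNl/=; case: (inner x y). Qed.

Lemma rdotDr x y z : rdot z (x + y) = rdot z x + rdot z y.
Proof. by rewrite !(rdotC z) rdotDl. Qed.

Lemma rdotNr x y : rdot x (- y) = - rdot x y.
Proof. by rewrite !(rdotC x) rdotNl. Qed.

Lemma innerDl x y z : inner (x + y) z = inner x z + inner y z.
Proof. by rewrite linearDl. Qed.

Lemma innerZl (c : R[i]) x y : inner (c *: x) y = c * inner x y.
Proof. by rewrite linearZl_LR. Qed.

Lemma innerZr (c : R[i]) x y : inner x (c *: y) = c^* * inner x y.
Proof. by rewrite linearZr_LR. Qed.

Lemma rdotZl (c : R) x y : rdot (c%:C *: x) y = c * rdot x y.
Proof.
by rewrite /rdot innerZl; case: (inner x y) => a b /=; rewrite mul0r subr0.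
Qed.

Lemma rdotZr (c : R) x y : rdot x (c%:C *: y) = c * rdot x y.
Proof. by rewrite !(rdotC x) rdotZl. Qed.

Lemma rdotxx x : rdot x x = complex.Re (`|x| ^+ 2).
Proof. by rewrite /rdot inner_norm. Qed.

Lemma rdot_ge0 x : 0 <= rdot x x.
Proof. by rewrite rdotxx complex_Re_ge0// exprn_ge0. Qed.

Lemma rdotxxC x : (rdot x x)%:C = `|x| ^+ 2.
Proof.
rewrite rdotxx. have : (0 : R[i]) <= `|x| ^+ 2 by rewrite exprn_ge0.
by case: (_ ^+ 2) => a b; rewrite lecE => /andP[/= /eqP-> _].
Qed.

Lemma rdot_eq0 x : rdot x x = 0 -> x = 0.
Proof.
move=> h; have := rdotxxC x; rewrite h => /esym/eqP.
by rewrite expf_eq0 normr_eq0 => /= /eqP.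
Qed.

Lemma rdotZZ (c : R[i]) x : rdot (c *: x) (c *: x) =
  (complex.Re c ^+ 2 + complex.Im c ^+ 2) * rdot x x.
Proof.
rewrite /rdot innerZl innerZr.
have : inner x x = (rdot x x)%:C by rewrite rdotxxC inner_norm.
rewrite /rdot => ->; case: c => a b /=; ring.
Qed.

End rdot.

(** * Integration against a density *)

Section density.
Context d (T : measurableType d) (R : realType).
Variables (m1 m2 mu : {measure set T -> \bar R}) (h : T -> R).
Hypotheses (h0 : forall x, 0 <= h x) (mh : measurable_fun setT h).
Hypothesis m12 : forall A, measurable A ->
  (m1 A = m2 A + \int[mu]_(x in A) (h x)%:E)%E.
Import HBNNSimple.

Lemma integral_add_density_nnsfun (s : {nnsfun T >-> R}) :
  (\int[m1]_x (s x)%:E =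
   \int[m2]_x (s x)%:E + \int[mu]_x (s x * h x)%:E)%E.
Proof.
have -> : (\int[mu]_x (s x * h x)%:E =
    \sum_(y \in range s) y%:E * \int[mu]_(x in s @^-1` [set y]) (h x)%:E)%E.
  rewrite (eq_integral (fun x => \sum_(y \in range s)
      ((y * \1_(s @^-1` [set y]) x)%:E * (h x)%:E)%E)); last first.
    move=> x _; rewrite EFinM (fimfunE s x) -fsumEFin// ge0_mule_fsuml//.
    by move=> y; exact: nnfun_muleindic_ge0.
  rewrite ge0_integral_fsum//; last 2 first.
  - move=> y; apply/measurable_EFinP; apply: measurable_funM => //.
    exact: measurable_funM.
  - by move=> y x _; rewrite mule_ge0 ?nnfun_muleindic_ge0// lee_fin.
  apply: eq_fsbigr => y; rewrite inE => -[x0 _ <-].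
  under eq_integral do rewrite EFinM -muleA.
  rewrite ge0_integralZl//.
  - congr (_ * _)%E; rewrite [RHS]integral_mkcond; apply: eq_integral => x _.
    by rewrite epatch_indic muleC.
  - apply/measurable_EFinP; apply: measurable_funM => //.
  - by move=> x _; rewrite -EFinM lee_fin mulr_ge0.
  - by rewrite lee_fin.
rewrite !integralT_nnsfun !sintegralE -fsbig_split//=.
apply: eq_fsbigr => y; rewrite inE => -[x0 _ <-].
by rewrite m12// ge0_muleDr// integral_ge0// => x _; rewrite lee_fin.
Qed.

(** The additive form [m1 = m2 + h mu] covers both a plain density, with
    [m2 = 0], and a difference of two measures that has a density, for which
    no signed measure has to be introduced. *)
Lemma integral_add_density (k : T -> R) : (forall x, 0 <= k x) ->
  measurable_fun setT k ->
  (\int[m1]_x (k x)%:E = \int[m2]_x (k x)%:E + \int[mu]_x (k x * h x)%:E)%E.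
Proof.
move=> k0 mk.
have mk' : measurable_fun setT (EFin \o k) by exact/measurable_EFinP.
have k0' x : [set: T] x -> (0 <= (EFin \o k) x)%E by rewrite lee_fin.
pose s := nnsfun_approx measurableT mk'.
have ks x : (k x)%:E = limn (fun n => (s n x)%:E).
  by apply/esym/cvg_lim => //; exact: cvg_nnsfun_approx.
have nds x : {homo (fun n => (s n x)%:E) : n m / (n <= m)%N >-> (n <= m)%E}.
  by move=> a b ab; rewrite lee_fin; exact/lefP/nd_nnsfun_approx.
have cvgs (m : {measure set T -> \bar R}) :
    (\int[m]_x (s n x)%:E @[n --> \oo] --> \int[m]_x (k x)%:E)%E.
  rewrite (eq_integral (fun x => limn (fun n => (s n x)%:E))); last first.
    by move=> x _; rewrite ks.
  apply: (@cvg_monotone_convergence _ _ _ m _ measurableT (fun n x => (s n x)%:E)).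
  - by move=> n; apply/measurable_EFinP.
  - by move=> n x _; rewrite lee_fin.
  - by move=> x _; exact: nds.
have cvgsh : (\int[mu]_x (s n x * h x)%:E @[n --> \oo] -->
    \int[mu]_x (k x * h x)%:E)%E.
  have ksh x : (k x * h x)%:E = limn (fun n => (s n x * h x)%:E).
    apply/esym/cvg_lim => //; rewrite EFinM; under eq_fun do rewrite EFinM.
    by apply: cvgeZr => //; exact: cvg_nnsfun_approx.
  rewrite (eq_integral (fun x => limn (fun n => (s n x * h x)%:E))); last first.
    by move=> x _; rewrite ksh.
  apply: (@cvg_monotone_convergence _ _ _ mu _ measurableT
    (fun n x => (s n x * h x)%:E)).
  - by move=> n; apply/measurable_EFinP; exact: measurable_funM.
  - by move=> n x _; rewrite lee_fin mulr_ge0.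
  - by move=> x _ a b ab; rewrite lee_fin ler_wpM2r// -lee_fin; exact: nds.
have := cvgs m1; under eq_fun do rewrite integral_add_density_nnsfun.
move/cvg_lim => <- //; apply/cvg_lim => //; apply: cvgeD => //.
  by rewrite ge0_adde_def// inE; apply: integral_ge0 => x _;
    rewrite lee_fin ?mulr_ge0.
Qed.
End density.

Section inverse_quadratic.
Context (R : realType).
Implicit Types (x y e : R).

Lemma sqrD_sqr_gt0 y e : e != 0 -> 0 < y ^+ 2 + e ^+ 2.
Proof. by move=> e0; rewrite ltr_wpDl ?sqr_ge0// exprn_even_gt0. Qed.

Lemma continuous_inv_sqrD e : e != 0 ->
  continuous (fun y : R => (y ^+ 2 + e ^+ 2)^-1).
Proof.
move=> e0 y; apply: cvgV; first by rewrite gt_eqF// sqrD_sqr_gt0.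
by apply: cvgD; [apply: exprn_continuous|exact: cvg_cst].
Qed.

Lemma measurable_inv_sqrD d (T : measurableType d) (f : T -> R) e : e != 0 ->
  measurable_fun setT f ->
  measurable_fun setT (fun t => (f t ^+ 2 + e ^+ 2)^-1).
Proof.
move=> e0 mf; apply: (@measurableT_comp _ _ _ _ _ _
  (fun y : R => (y ^+ 2 + e ^+ 2)^-1)) => //.
exact: continuous_measurable_fun (continuous_inv_sqrD e0).
Qed.
End inverse_quadratic.

(** * Spectral measures and resolvents *)

Section spectral_measure.
Context (R : realType) (H : hilbertType R) (E : pvm H).
Implicit Types (x y u : H) (B C : set R).
Local Notation mu := (pvm_measure E).

Lemma pvm_selfadjoint B x y : measurable B -> rdot (E B x) y = rdot x (E B y).
Proof. by move=> mB; rewrite /rdot (pvm_projection E mB).2. Qed.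

Lemma pvm_idem B x : measurable B -> E B (E B x) = E B x.
Proof. by move=> mB; rewrite (pvm_projection E mB).1. Qed.

Lemma pvm_measureE B x : measurable B -> mu x B = (rdot (E B x) (E B x))%:E.
Proof.
move=> mB; rewrite /pvm_measure asboolT//.
by rewrite pvm_selfadjoint// pvm_idem.
Qed.

Lemma pvm_measureT x : mu x setT = (rdot x x)%:E.
Proof. by rewrite pvm_measureE// pvm_setT. Qed.

Lemma pvm_measure_fin_num x : fin_num_fun (mu x).
Proof. by move=> B mB; rewrite pvm_measureE. Qed.

HB.instance Definition _ x := Measure_isFinite.Build _ _ _ (mu x)
  (pvm_measure_fin_num x).

Lemma pvm_measure_proj B C x : measurable B -> measurable C ->
  mu (E B x) C = mu x (C `&` B).
Proof.
move=> mB mC; rewrite !pvm_measureE//; last exact: measurableI.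
by rewrite pvm_setI.
Qed.

Lemma pvm_disj B C x : measurable B -> measurable C -> B `&` C = set0 ->
  E B (E C x) = 0.
Proof. by move=> mB mC BC; rewrite -pvm_setI// BC pvm_set0. Qed.

Lemma pvm_setU B C x : measurable B -> measurable C -> B `&` C = set0 ->
  mu x (B `|` C) = (mu x B + mu x C)%E.
Proof. by move=> mB mC BC; rewrite measureU//. Qed.

Lemma pvm_measure_split B x C : measurable B -> measurable C ->
  mu x C = (mu (E B x) C + mu (E (~` B) x) C)%E.
Proof.
move=> mB mC; have mBc := measurableC mB.
rewrite !pvm_measure_proj// -measureU//; last 3 first.
- exact: measurableI.
- exact: measurableI.
- by rewrite setIACA setICr setI0.
by rewrite -setIUr setUv setIT.
Qed.

Lemma integral_pvm_measure_proj B x (h : R -> R) : measurable B ->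
  measurable_fun setT h -> (forall t, 0 <= h t) ->
  (\int[mu (E B x)]_t (h t)%:E = \int[mu x]_(t in B) (h t)%:E)%E.
Proof.
move=> mB mh h0; have mBc := measurableC mB.
have mh' D : measurable_fun D (EFin \o h).
  by apply/measurable_EFinP; exact: measurable_funTS.
rewrite -(setUv B) ge0_integral_setU//; last 2 first.
- by move=> t _; rewrite lee_fin.
- by apply/disj_setPS => t [].
rewrite [X in (_ + X)%E]null_set_integral//; last first.
  by rewrite [LHS]pvm_measure_proj// setICl; exact: pvm_measure0.
rewrite adde0; apply: eq_measure_integral => C mC CB.
by rewrite [LHS]pvm_measure_proj// setIidl.
Qed.

Lemma pvm_orth B x y : measurable B -> rdot (E B x) (E (~` B) y) = 0.
Proof.
move=> mB; rewrite pvm_selfadjoint// pvm_disj//.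
- by rewrite /rdot linear0r.
- exact: measurableC.
- exact: setICr.
Qed.

Lemma pvm_setC B x : measurable B -> x = E B x + E (~` B) x.
Proof.
move=> mB; have mBc := measurableC mB.
apply/eqP; rewrite -subr_eq0; apply/eqP; apply: rdot_eq0.
have Ed y : rdot (E B x) y = rdot (E B x) (E B y).
  by rewrite -{1}(pvm_idem x mB) pvm_selfadjoint.
have Edc y : rdot (E (~` B) x) y = rdot (E (~` B) x) (E (~` B) y).
  by rewrite -{1}(pvm_idem x mBc) pvm_selfadjoint.
have : mu x setT = (mu x B + mu x (~` B))%E.
  by rewrite -pvm_setU ?setICr// setUv.
rewrite pvm_measureT !pvm_measureE// => -[xx].
rewrite !opprD !(rdotDl, rdotDr) !(rdotNl, rdotNr).
rewrite (rdotC x (E B x)) (rdotC x (E (~` B) x)) (rdotC (E (~` B) x) (E B x)).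
rewrite (Ed x) (Edc x) xx (pvm_orth x x mB); ring.
Qed.

End spectral_measure.

Section quadratic_form.
Context (R : realType) (H : hilbertType R) (E : pvm H).
Variables (T : {linear H -> H}) (tau : R -> R) (M : R).
Hypotheses (tau0 : forall t, 0 <= tau t) (tauM : forall t, tau t <= M)
  (mtau : measurable_fun setT tau).
Hypothesis T_real : forall x, complex.Im (inner (T x) x) = 0.
Hypothesis T_form : forall x,
  (rdot (T x) x)%:E = (\int[pvm_measure E x]_t (tau t)%:E)%E.
Local Notation mu := (pvm_measure E).

(** A complex quadratic form that is real on all vectors is Hermitian: test it
    on [x + i y]. *)
Lemma quad_symmetric x y : rdot (T x) y = rdot x (T y).
Proof.
have := T_real (x + 'i *: y); have := T_real x; have := T_real y.
rewrite linearD/= linearZ/= linearDl !linearDr/= !innerZl !innerZr.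
rewrite (rdotC x) /rdot.
case: (inner (T x) x) => a b; case: (inner (T y) y) => c d.
case: (inner (T x) y) => e f; case: (inner (T y) x) => g h /=.
lra.
Qed.

(** The measure of [x] is the sum of the measures of its two components, so
    the quadratic form is additive along them and its cross term vanishes. *)
Lemma quad_proj_orth B x : measurable B -> rdot (T (E B x)) (E (~` B) x) = 0.
Proof.
move=> mB; have mBc := measurableC mB.
have : (rdot (T x) x)%:E =
    ((rdot (T (E B x)) (E B x))%:E + (rdot (T (E (~` B) x)) (E (~` B) x))%:E)%E.
  rewrite !T_form -ge0_integral_measure_add//; last 2 first.
  - by move=> t _; rewrite lee_fin.
  - exact/measurable_EFinP.
  apply: eq_measure_integral => C mC _; rewrite [RHS]measure_addE.
  exact: pvm_measure_split.
rewrite [in LHS](pvm_setC E x mB).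
move: (E B x) (E (~` B) x) => y z [].
rewrite linearD/= !(rdotDl, rdotDr) (quad_symmetric z y) (rdotC _ (T _)); lra.
Qed.

Lemma quad_proj_invariant B x : measurable B ->
  T (E B x) = E B (T (E B x)).
Proof.
move=> mB; have mBc := measurableC mB.
rewrite {1}(pvm_setC E (T (E B x)) mB).
suff -> : E (~` B) (T (E B x)) = 0 by rewrite addr0.
apply: rdot_eq0; rewrite pvm_selfadjoint// pvm_idem//.
have := quad_proj_orth (E B x + E (~` B) (T (E B x))) mB.
rewrite !linearD/= !(pvm_idem _ _ mB) !(pvm_idem _ _ mBc).
rewrite (pvm_disj _ _ mB mBc) ?setICr// (pvm_disj _ _ mBc mB) ?setICl//.
by rewrite linear0 addr0 add0r.
Qed.

Lemma quad_commute B x : measurable B -> E B (T x) = T (E B x).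
Proof.
move=> mB; have mBc := measurableC mB.
rewrite {1}(pvm_setC E x mB) !linearD/= -quad_proj_invariant//.
by rewrite (quad_proj_invariant _ mBc) pvm_disj ?setICr// addr0.
Qed.

Lemma quad_integral B x : measurable B ->
  (rdot (T (E B x)) (E B x))%:E = (\int[mu x]_(t in B) (tau t)%:E)%E.
Proof. by move=> mB; rewrite T_form integral_pvm_measure_proj. Qed.

(** The hypothesis on [T] only speaks of [<T x, x>]; the norm of [T u] is
    reached by polarization. The measures of [T u + u] and [T u - u] differ by
    [4 Re <E(B) T u, u>], which by [quad_integral] is the measure of density
    [4 tau] with respect to that of [u]; integrating [tau] once more against
    them gives [tau ^ 2]. Nonnegativity of [tau] keeps all these measures
    positive. *)
Lemma quad_norm_sq u :
  (rdot (T u) (T u))%:E = (\int[mu u]_t (tau t * tau t)%:E)%E.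
Proof.
have dens B : measurable B -> (mu (T u + u)%R B =
    mu (T u - u)%R B + \int[mu u]_(t in B) (4 * tau t)%:E)%E.
  move=> mB; under eq_integral do rewrite EFinM.
  rewrite ge0_integralZl//; last 2 first.
  - by apply/measurable_EFinP; exact: measurable_funTS.
  - by move=> t _; rewrite lee_fin.
  rewrite -quad_integral// !pvm_measureE// !linearD/= linearN/= quad_commute//.
  rewrite -EFinM -EFinD; congr EFin.
  rewrite !(rdotDl, rdotDr) !(rdotNl, rdotNr) (rdotC (E B u) (T _)); lra.
have tau4 t : 0 <= 4 * tau t by rewrite mulr_ge0.
have mtau4 : measurable_fun setT (fun t => 4 * tau t).
  exact: measurable_funM.
have := integral_add_density tau4 mtau4 dens tau0 mtau.
rewrite -!T_form.
under eq_integral do rewrite mulrCA EFinM.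
rewrite ge0_integralZl//; last 2 first.
- by apply/measurable_EFinP; exact: measurable_funM.
- by move=> t _; rewrite lee_fin mulr_ge0.
set I := (\int[_]_t _)%E.
have : (0 <= I)%E by apply: integral_ge0 => t _; rewrite lee_fin mulr_ge0.
case: I => [I _| _|]//; last by rewrite gt0_muley ?lte_fin// addey.
rewrite -EFinM -EFinD => -[].
rewrite linearD/= linearB/= !(rdotDl, rdotDr) !(rdotNl, rdotNr).
rewrite (quad_symmetric (T u) u) => h; congr EFin; lra.
Qed.

Lemma integrable_pvm_bounded u (h : R -> R) (K : R) :
  measurable_fun setT h -> (forall t, `|h t| <= K) ->
  (mu u).-integrable setT (EFin \o h).
Proof.
move=> mh hK; apply: measurable_bounded_integrable => //.
  by rewrite [X in (X < _)%E]pvm_measureT ltry.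
exists K; split; first exact: num_real.
by move=> N KN t _; rewrite /= (le_trans (hK t))// ltW.
Qed.

Lemma quad_shift_norm_sq u (x e : R) :
  (rdot (T u - (x +i* e) *: u) (T u - (x +i* e) *: u))%:E =
  (\int[mu u]_t ((tau t - x) ^+ 2 + e ^+ 2)%:E)%E.
Proof.
have mtau2 : measurable_fun setT (fun t => tau t * tau t).
  exact: measurable_funM.
have i2 : (mu u).-integrable setT (EFin \o (fun t => tau t * tau t)).
  apply: (@integrable_pvm_bounded u _ (M * M)) => // t.
  by rewrite ger0_norm ?mulr_ge0// ler_pM.
have i1 : (mu u).-integrable setT (EFin \o (fun t => - 2 * x * tau t)).
  apply: (@integrable_pvm_bounded u _ (`|- 2 * x| * M)) => //.
    exact: measurable_funM.
  by move=> t; rewrite normrM ler_wpM2l// ger0_norm.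
have i0 : (mu u).-integrable setT (EFin \o cst (x ^+ 2 + e ^+ 2)).
  by apply: (@integrable_pvm_bounded u _ (`|x ^+ 2 + e ^+ 2|)).
transitivity (\int[mu u]_t (((tau t * tau t)%:E + (- 2 * x * tau t)%:E) +
    (cst (x ^+ 2 + e ^+ 2) t)%:E))%E; last first.
  by apply: eq_integral => t _; rewrite -!EFinD /=; congr EFin; ring.
rewrite integralD//; last exact: integrableD.
rewrite integralD//.
have -> : (\int[mu u]_t (cst (x ^+ 2 + e ^+ 2) t)%:E =
    (x ^+ 2 + e ^+ 2)%:E * (rdot u u)%:E)%E.
  rewrite -(pvm_measureT E u).
  exact: (integral_cst (mu u) measurableT (x ^+ 2 + e ^+ 2)%:E).
have -> : (\int[mu u]_t (- 2 * x * tau t)%:E =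
    (- 2 * x)%:E * \int[mu u]_t (tau t)%:E)%E.
  under eq_integral do rewrite EFinM.
  rewrite integralZl//; apply: (@integrable_pvm_bounded u _ (M)) => // t.
  by rewrite ger0_norm.
rewrite -quad_norm_sq -T_form -!EFinM -!EFinD; congr EFin.
have -> : (x +i* e) = x%:C + 'i * e%:C :> R[i].
  by apply/eqP; rewrite eq_complex /=; apply/andP; split; apply/eqP; ring.
have := T_real u; rewrite scalerDl opprD !(rdotDl, rdotDr) !(rdotNl, rdotNr).
rewrite !(rdotZl, rdotZr) rdotZZ /= /rdot !(innerZl, innerZr).
rewrite [inner u (T u)]innerC.
have -> : inner u u = (rdot u u)%:C by rewrite rdotxxC inner_norm.
move: (inner (T u) u) (inner (T u) (T u)) => [a b] [c d] /= ->.
ring.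
Qed.

(** As [T] commutes with the projections, the measure of [phi = (T - z) v] has
    density [|tau - z|^2] with respect to that of [v], and the integrand below
    cancels this density. *)
Lemma quad_resolvent v phi (x e : R) : e != 0 ->
  phi = T v - (x +i* e) *: v ->
  (\int[mu phi]_t (((tau t - x) ^+ 2 + e ^+ 2)^-1)%:E = (rdot v v)%:E)%E.
Proof.
move=> e0 phiE; set h := fun t => (tau t - x) ^+ 2 + e ^+ 2.
have h_gt0 t : 0 < h t by exact: sqrD_sqr_gt0.
have mh : measurable_fun setT h.
  apply: measurable_funD => //.
  by apply: (measurable_funX 2); exact: measurable_funB.
have mVh : measurable_fun setT (fun t => (h t)^-1).
  by apply: measurable_inv_sqrD => //; exact: measurable_funB.
have dens B : measurable B -> (mu phi B =
    mzero B + \int[mu v]_(t in B) (h t)%:E)%E.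
  move=> mB; rewrite /mzero add0e pvm_measureE// phiE linearB/= linearZ/=.
  rewrite quad_commute// quad_shift_norm_sq integral_pvm_measure_proj// => t.
  by rewrite addr_ge0 ?sqr_ge0.
have h0 t : 0 <= h t := ltW (h_gt0 t).
have Vh0 t : 0 <= (h t)^-1 by rewrite invr_ge0.
rewrite (integral_add_density h0 mh dens Vh0 mVh) integral_measure_zero add0e.
under eq_integral do rewrite mulVf ?gt_eqF//.
rewrite -(pvm_measureT E v) -[RHS]mul1e.
exact: (integral_cst (mu v) measurableT 1%E).
Qed.

End quadratic_form.

Section spectral_resolvent.
Context (R : realType) (H : hilbertType R) (E : pvm H) (A : {linear H -> H}).
Hypothesis EA : is_spectral_measure E A.
Local Notation mu := (pvm_measure E).

Lemma spectral_real x : complex.Im (inner (A x) x) = 0.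
Proof. by rewrite EA.2. Qed.

(** [quad_resolvent] applies to [A + a], where the support of the spectral
    measure is in [[-a, a]]: its multiplier [t + a] is nonnegative and bounded
    on the support, and is truncated elsewhere. *)
Lemma spectral_resolvent v phi (x e : R) : e != 0 ->
  phi = A v - (x +i* e) *: v ->
  (\int[mu phi]_t (((t - x) ^+ 2 + e ^+ 2)^-1)%:E = (rdot v v)%:E)%E.
Proof.
move=> e0 phiE; have [[a Ea] Aform] := EA.
(* For [a < 0] the support is empty and [H] is the zero space. *)
wlog a0 : a Ea / 0 <= a.
  case: (leP 0 a) => [a0 /(_ a)|a0 _]; first exact.
  have E0 (y : H) : y = 0.
    rewrite -(Ea y) (_ : `[- a, a]%classic = set0) ?pvm_set0//.
    by rewrite set_itv_ge// bnd_simp -ltNge; lra.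
  rewrite (E0 phi) (E0 v) /rdot linear0l /=.
  rewrite (eq_measure_integral mzero) ?integral_measure_zero// => B mB _.
  by rewrite [LHS]pvm_measureE// linear0 /rdot linear0l.
pose I := `[- a, a]%classic : set R.
pose tau (t : R) := Num.min (Num.max (t + a) 0) (2 * a).
have tau0 t : 0 <= tau t by rewrite le_min le_max lexx orbT mulr_ge0.
have tauM t : tau t <= 2 * a by rewrite ge_min lexx orbT.
have mtau : measurable_fun setT tau.
  apply: measurable_minr => //; apply: measurable_maxr => //.
  exact: measurable_funD.
have tauE t : I t -> tau t = t + a.
  rewrite /I /= in_itv/= => /andP[ta1 ta2].
  by rewrite /tau max_l ?min_l//; lra.
have mI : measurable I by exact: measurable_itv.
have mIc : measurable (~` I) := measurableC mI.
have muIc u : mu u (~` I) = 0.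
  rewrite pvm_measureE// -(Ea u) pvm_disj// ?setICl//.
  by rewrite /rdot linear0l.
have aeI u (f g : R -> R) : (forall t, I t -> f t = g t) ->
    ae_eq (mu u) setT (EFin \o f) (EFin \o g).
  move=> fg; exists (~` I); split; [exact: mIc|exact: muIc|move=> t /= h It].
  by apply: h => _; rewrite fg.
have itau u : (mu u).-integrable setT (EFin \o tau).
  apply: (@integrable_pvm_bounded _ _ E u _ (2 * a)) => // t.
  by rewrite ger0_norm.
have icst u c : (mu u).-integrable setT (EFin \o cst c).
  by apply: (@integrable_pvm_bounded _ _ E u _ `|c|).
pose T : {linear H -> H} := A \+ (a%:C \*: idfun).
have TE y : T y = A y + a%:C *: y by [].
have T_real y : complex.Im (inner (T y) y) = 0.
  rewrite TE linearDl/= innerZl.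
  have -> : inner y y = (rdot y y)%:C by rewrite rdotxxC inner_norm.
  move: (spectral_real y); case: (inner (A y) y) => b c /= ->; ring.
have T_form y : (rdot (T y) y)%:E = (\int[mu y]_t (tau t)%:E)%E.
  have -> : rdot (T y) y = \int[mu y]_t t + a * rdot y y.
    by rewrite TE rdotDl rdotZl /rdot Aform.
  rewrite /Rintegral.
  have -> : (\int[mu y]_t t%:E = \int[mu y]_t ((tau t)%:E - (cst a t)%:E))%E.
    apply: ae_eq_integral => //.
    - by apply: emeasurable_funB; exact/measurable_EFinP.
    - by apply: (aeI y id (fun t => tau t - a)) => t It; rewrite tauE// addrK.
  rewrite integralB//; [|exact: itau|exact: icst].
  have -> : (\int[mu y]_t (cst a t)%:E = a%:E * (rdot y y)%:E)%E.
    rewrite -(pvm_measureT E y).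
    exact: (integral_cst (mu y) measurableT a%:E).
  have := integrable_fin_num measurableT (itau y).
  move: (\int[mu y]_t _)%E => [c|//|//] _ /=.
  by congr EFin; ring.
have phiE' : phi = T v - ((x + a) +i* e) *: v.
  rewrite phiE TE (_ : (x + a) +i* e = a%:C + (x +i* e)); last first.
    by apply/eqP; rewrite eq_complex /= add0r addrC !eqxx.
  by rewrite scalerDl opprD addrA addrK.
rewrite -(quad_resolvent tau0 tauM mtau T_real T_form e0 phiE').
apply: ae_eq_integral => //.
- apply/measurable_EFinP; apply: measurable_inv_sqrD => //.
  exact: measurable_funB.
- apply/measurable_EFinP; apply: measurable_inv_sqrD => //.
  exact: measurable_funB.
- apply: (aeI phi (fun t => ((t - x) ^+ 2 + e ^+ 2)^-1)
    (fun t => ((tau t - (x + a)) ^+ 2 + e ^+ 2)^-1)) => t It.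
  by rewrite tauE// opprD addrACA subrr addr0.
Qed.
End spectral_resolvent.

(** * Poisson integrals *)

Section poisson.
Context (R : realType).
Implicit Types (x t a b e : R).

Definition poisson e t x : R := e * ((x - t) ^+ 2 + e ^+ 2)^-1.

Lemma poisson_ge0 e t x : 0 < e -> 0 <= poisson e t x.
Proof.
by move=> e0; rewrite mulr_ge0 ?invr_ge0 ?addr_ge0 ?sqr_ge0// ltW.
Qed.

Lemma is_derive_atan_affine e t x : 0 < e ->
  is_derive x (1 : R) (fun y => atan (e^-1 * (y - t))) (poisson e t x).
Proof.
move=> e0.
have h : is_derive x (1 : R) (fun y => e^-1 * (y - t)) e^-1.
  by apply: is_derive_eq; rewrite oppr0 addr0 scaler1.
apply: (@is_derive_eq _ _ _ _ _ _ _ _ (is_derive1_comp (is_derive1_atan _) h)).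
rewrite /poisson; field.
by rewrite gt_eqF ?sqrD_sqr_gt0 ?gt_eqF.
Qed.

Lemma integral_poisson a b e t : a < b -> 0 < e ->
  (\int[lebesgue_measure]_(x in `[a, b]) (poisson e t x)%:E =
   (atan (e^-1 * (b - t)) - atan (e^-1 * (a - t)))%:E)%E.
Proof.
move=> ab e0; set F := fun y => atan (e^-1 * (y - t)).
have dF x : derivable F x 1 by apply: ex_derive; exact: is_derive_atan_affine.
have cF : continuous F.
  by move=> x; apply: differentiable_continuous; apply/derivable1_diffP.
rewrite (@continuous_FTC2 _ (poisson e t) F) ?EFinB//.
- apply: continuous_subspaceT => x.
  apply: cvgM; first exact: cvg_cst.
  apply: (@continuous_comp _ _ _ (fun y => y - t)
    (fun y => (y ^+ 2 + e ^+ 2)^-1)).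
    by apply: cvgB; [exact: cvg_id|exact: cvg_cst].
  by apply: continuous_inv_sqrD; rewrite gt_eqF.
- split => //.
  + by apply: cvg_at_right_filter; exact: cF.
  + by apply: cvg_at_left_filter; exact: cF.
- move=> x _; rewrite derive1E; apply: derive_val.
  exact: is_derive_atan_affine.
Qed.

Lemma measurable_poisson e : 0 < e ->
  measurable_fun setT (fun z : R * R => poisson e z.2 z.1).
Proof.
move=> e0; apply: measurable_funM => //.
apply: measurable_inv_sqrD; first by rewrite gt_eqF.
exact: measurable_funB.
Qed.

End poisson.

Section stieltjes_local.
Context (R : realType) (m : {finite_measure set R -> \bar R}).
Implicit Types (x t a b e : R).
Local Notation leb := (@lebesgue_measure R).

Definition poisson_int e x : \bar R := (\int[m]_t (poisson e t x)%:E)%E.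

Lemma poisson_int_ge0 e x : 0 < e -> (0 <= poisson_int e x)%E.
Proof. by move=> e0; apply: integral_ge0 => t _; rewrite lee_fin poisson_ge0. Qed.

Lemma measurable_poisson_int e : 0 < e -> measurable_fun setT (poisson_int e).
Proof.
move=> e0.
apply: (measurable_fun_fubini_tonelli_F (T1 := R) (m2 := m)
  (fun z : R * R => (poisson e z.2 z.1)%:E)).
- apply/measurable_EFinP; exact: measurable_poisson.
- by move=> z; rewrite lee_fin poisson_ge0.
Qed.

Lemma integral_poisson_int a b e : a < b -> 0 < e ->
  (\int[leb]_(x in `[a, b]) poisson_int e x =
   \int[m]_t (atan (e^-1 * (b - t)) - atan (e^-1 * (a - t)))%:E)%E.
Proof.
move=> ab e0.
transitivity (\int[leb]_x \int[m]_t
    ((poisson e t x) * \1_(`[a, b]%classic) x)%:E)%E.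
  rewrite integral_mkcond; apply: eq_integral => x _.
  rewrite patchE indicE; case: ifPn => xab.
    by apply: eq_integral => t _; rewrite mulr1.
  by rewrite integral0_eq// => t _; rewrite mulr0.
rewrite (fubini_tonelli (T1 := measurableTypeR R) (m1 := leb) (m2 := m)
  (fun z => (poisson e z.2 z.1 * \1_(`[a, b]%classic) z.1)%:E)); last 2 first.
- apply/measurable_EFinP; apply: measurable_funM.
    exact: measurable_poisson.
  by apply: measurableT_comp => //; exact: measurable_indic.
- by move=> z; rewrite lee_fin mulr_ge0// poisson_ge0.
apply: eq_integral => t _; rewrite -integral_poisson//.
rewrite [RHS]integral_mkcond; apply: eq_integral => x _.
by rewrite patchE indicE /=; case: ifPn => _; rewrite ?mulr1 ?mulr0.
Qed.

(** An atom of mass [c] at [x] contributes [c / e] to the Poisson integral at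
    [x], which is unbounded as [e] tends to 0. *)
Lemma bounded_poisson_int_atom x (K d : R) : 0 < d ->
  (forall e, 0 < e < d -> (poisson_int e x <= K%:E)%E) -> m [set x] = 0%E.
Proof.
move=> d0 HK.
have mx : m [set x] \is a fin_num by exact: fin_num_measure.
have key e : 0 < e < d -> fine (m [set x]) <= K * e.
  move=> /[dup] ed /andP[e0 _]; rewrite -ler_pdivrMr// -lee_fin.
  apply: le_trans (HK _ ed).
  apply: (@le_trans _ _ (\int[m]_(t in [set x]) (poisson e t x)%:E)%E).
    rewrite (eq_integral (cst (e^-1)%:E)).
      by rewrite integral_cst// EFinM fineK// muleC.
    move=> t; rewrite inE => ->; congr EFin.
    rewrite /poisson subrr expr0n /= add0r expr2 invfM mulrA mulfV ?mul1r//.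
    by rewrite gt_eqF.
  apply: ge0_subset_integral => //.
  - apply/measurable_EFinP; apply: measurable_funM => //.
    by apply: measurable_inv_sqrD; [rewrite gt_eqF|exact: measurable_funB].
  - by move=> t _; rewrite lee_fin poisson_ge0.
rewrite -(fineK mx); congr EFin.
set c := fine _ in key *.
have c0 : 0 <= c by rewrite fine_ge0.
apply/eqP; rewrite eq_le c0 andbT leNgt; apply/negP => cpos.
have K1 : 0 < `|K| + 1 by rewrite ltr_wpDl.
pose e := Num.min (d / 2) (c / (2 * (`|K| + 1))).
have e0 : 0 < e by rewrite lt_min !divr_gt0// mulr_gt0.
have ed : e < d by rewrite gt_min ltr_pdivrMr// ltr_pMr// ltr1n.
have := key e; rewrite e0 ed => /(_ isT); apply/negP; rewrite -ltNge.
apply: (@le_lt_trans _ _ ((`|K| + 1) * e)).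
  apply: ler_wpM2r; first exact: ltW.
  by apply: (le_trans (ler_norm K)); rewrite lerDl.
apply: (@le_lt_trans _ _ (c / 2)); last by lra.
rewrite mulrC -ler_pdivlMr// ge_min; apply/orP; right.
by rewrite invfM mulrA.
Qed.


Let eps (d : R) (n : nat) : R := d / n.+2%:R.

Let eps_in d n : 0 < d -> 0 < eps d n < d.
Proof.
by move=> d0; rewrite divr_gt0//= ltr_pdivrMr// ltr_pMr// ltr1n.
Qed.

Let eps_eventually d c : 0 < c -> \forall n \near \oo, eps d n < c.
Proof.
move=> c0; near=> n; rewrite /eps ltr_pdivrMr// mulrC -ltr_pdivrMr//.
apply: (@lt_trans _ _ n%:R); last by rewrite ltr_nat.
by near: n; exact: nbhs_infty_gtr.
Unshelve. all: by end_near. Qed.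

Let atan_eps_cvg d y : 0 < d ->
  atan ((eps d n)^-1 * y) @[n --> \oo] --> pi / 2 * Num.sg y.
Proof.
move=> d0; wlog y0 : y / 0 < y.
  move=> wl; case: (ltgtP y 0) => [yn|yp|->].
  - have -> : (fun n => atan ((eps d n)^-1 * y)) =
        (fun n => - atan ((eps d n)^-1 * (- y))).
      by apply/funext => n; rewrite mulrN atanN opprK.
    rewrite -[in Num.sg _](opprK y) sgrN mulrN.
    by apply: cvgN; apply: wl; rewrite oppr_gt0.
  - exact: wl.
  - by under eq_fun do rewrite mulr0 atan0; rewrite sgr0 mulr0; exact: cvg_cst.
rewrite gtr0_sg// mulr1.
apply: (@cvg_comp _ _ _ (fun n => (eps d n)^-1 * y) atan _ (+oo : set_system R));
  last exact: cvgy_atan.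
apply/cvgryPgt => A; near=> n.
rewrite /eps invf_div mulrAC ltr_pdivlMr//.
rewrite -ltr_pdivrMr//; apply: (@lt_trans _ _ n%:R); last by rewrite ltr_nat.
by near: n; exact: nbhs_infty_gtr.
Unshelve. all: by end_near. Qed.

(** Integrate the Poisson integral over [[a, b]] along a sequence [e -> 0]. By
    dominated convergence the integral tends to that of [pi f]; by Fubini it
    is also the [m]-integral of a difference of arctangents, which tends to
    [pi] inside the interval, to [pi / 2] at its endpoints, and to 0 outside.
    The endpoints carry no mass by [bounded_poisson_int_atom]. *)
Lemma stieltjes_local a b (f : R -> R) (K d : R) : a < b -> 0 < d ->
  measurable_fun setT f -> (forall x, 0 <= f x) ->
  (forall x, a <= x <= b -> forall e : R, 0 < e < d ->
    (poisson_int e x <= K%:E)%E) ->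
  (forall x, a <= x <= b -> forall c : R, 0 < c -> exists2 d' : R, 0 < d' &
    forall e : R, 0 < e < d' -> `|fine (poisson_int e x) - pi * f x| < c) ->
  (m `]a, b[%classic = \int[leb]_(x in `[a, b]) (f x)%:E)%E.
Proof.
move=> ab d0 mf f0 HK Hf.
have ma : m [set a] = 0%E.
  by apply: (bounded_poisson_int_atom d0) (HK a _); rewrite lexx ltW.
have mb : m [set b] = 0%E.
  by apply: (bounded_poisson_int_atom d0) (HK b _); rewrite lexx ltW.
pose I n := (\int[leb]_(x in `[a, b]) poisson_int (eps d n) x)%E.
have I1 : (I n @[n --> \oo] -->
    \int[leb]_(x in `[a, b]) (pi * f x)%:E)%E.
  apply: (@dominated_cvg _ _ _ leb _ _ (fun n => poisson_int (eps d n)) _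
    (cst K%:E)) => //.
  - move=> n; apply: measurable_funTS; apply: measurable_poisson_int.
    by have /andP[] := eps_in n d0.
  - move=> x xab; apply/fine_cvgP; split.
      near=> n; rewrite ge0_fin_numE; last first.
        by apply: poisson_int_ge0; have /andP[] := eps_in n d0.
      by apply: le_lt_trans (HK x xab _ (eps_in n d0)) _; rewrite ltry.
    apply/cvgrPdist_lt => c c0; have [d' d'0 Hd'] := Hf x xab c c0.
    near=> n; rewrite distrC; apply: Hd'.
    have /andP[-> _] := eps_in n d0; near: n; exact: eps_eventually.
  - exact: (@continuous_compact_integrable _ (cst K) _ (@segment_compact _ a b)
      (@continuous_subspaceT _ _ _ _ (@cst_continuous _ _ K))).
  - move=> n x xab; have /andP[e0 _] := eps_in n d0.
    by rewrite gee0_abs ?poisson_int_ge0// HK// eps_in.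
pose h t : R := pi * \1_(`]a, b[%classic) t +
  pi / 2 * (\1_[set a] t + \1_[set b] t).
have hE t : h t = pi / 2 * Num.sg (b - t) - pi / 2 * Num.sg (a - t).
  rewrite /h !indicE.
  have -> : (t \in `]a, b[%classic) = (a < t < b) by rewrite mem_setE in_itv.
  have -> : (t \in [set a]) = (t == a) by apply/idP/eqP; rewrite inE.
  have -> : (t \in [set b]) = (t == b) by apply/idP/eqP; rewrite inE.
  case: (ltgtP t a) => [ta|ta|->].
  - rewrite !gtr0_sg ?subr_gt0// ?(lt_trans ta)// lt_eqF ?(lt_trans ta)//=.
    ring.
  - rewrite (ltr0_sg (_ : a - t < 0)) ?subr_lt0//.
    case: (ltgtP t b) => [tb|tb|->] /=.
    + by rewrite gtr0_sg ?subr_gt0//; field.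
    + by rewrite ltr0_sg ?subr_lt0//; field.
    + by rewrite subrr sgr0; field.
  - by rewrite subrr sgr0 gtr0_sg ?subr_gt0// lt_eqF//=; field.
have mh : measurable_fun setT h.
  apply: measurable_funD; apply: measurable_funM => //.
  by apply: measurable_funD; exact: measurable_indic.
have I2 : (I n @[n --> \oo] --> \int[m]_t (h t)%:E)%E.
  pose g n t := atan ((eps d n)^-1 * (b - t)) - atan ((eps d n)^-1 * (a - t)).
  have -> : I = fun n => (\int[m]_t (g n t)%:E)%E.
    apply/funext => n; apply: integral_poisson_int => //.
    by have /andP[] := eps_in n d0.
  have mg n : measurable_fun setT (g n).
    have matan := continuous_measurable_fun (@continuous_atan R).
    apply: measurable_funB; apply: measurableT_comp => //;
      by apply: measurable_funM => //; exact: measurable_funB.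
  apply: (@dominated_cvg _ _ _ m _ measurableT (fun n t => (g n t)%:E) _
    (cst pi%:E)) => //.
  - by move=> n; apply/measurable_EFinP.
  - move=> t _; apply/fine_cvgP; split; first exact: nearW.
    by rewrite /= hE; apply: cvgB; exact: atan_eps_cvg.
  - exact: (finite_measure_integrable_cst m pi measurableT).
  - move=> n t _; rewrite lee_fin /g.
    have [] := (atan_gtNpi2 ((eps d n)^-1 * (b - t)), atan_ltpi2 ((eps d n)^-1 * (b - t))).
    have [] := (atan_gtNpi2 ((eps d n)^-1 * (a - t)), atan_ltpi2 ((eps d n)^-1 * (a - t))).
    move: (atan _) (atan _) => u v *; rewrite ler_norml; apply/andP; split; lra.
have -> : (m `]a, b[%classic = (pi^-1)%:E * \int[m]_t (h t)%:E)%E.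
  have -> : (\int[m]_t (h t)%:E = \int[m]_t (pi * \1_(`]a, b[%classic) t)%:E)%E.
    apply: ae_eq_integral => //.
    - exact/measurable_EFinP.
    - by apply/measurable_EFinP; apply: measurable_funM => //; exact: measurable_indic.
    - exists ([set a] `|` [set b]); split.
      + exact: measurableU.
      + by apply/eqP; rewrite eq_le measure_ge0 andbT -(adde0 0%E) -{1}ma -mb measureU2.
      + move=> t /= ht; apply: contrapT => /not_orP[ta tb]; apply: ht => _.
        rewrite /h !indicE (@memNset _ [set a] t ta) (@memNset _ [set b] t tb).
        by rewrite !mulr0n addr0 mulr0 addr0.
  under eq_integral do rewrite EFinM.
  rewrite ge0_integralZl// ?integral_indic// ?lee_fin ?pi_ge0//; last first.
    by apply/measurable_EFinP; exact: measurable_indic.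
  by rewrite setIT muleA -EFinM mulVf ?mul1e// gt_eqF ?pi_gt0.
have <- : (\int[leb]_(x in `[a, b]) (pi * f x)%:E = \int[m]_t (h t)%:E)%E.
  by rewrite -(cvg_lim _ I1)// (cvg_lim _ I2).
under eq_integral do rewrite EFinM.
rewrite ge0_integralZl//; last 3 first.
- by apply/measurable_EFinP; exact: measurable_funTS.
- by move=> t _; rewrite lee_fin.
- by rewrite lee_fin pi_ge0.
by rewrite muleA -EFinM mulVf ?mul1e// gt_eqF ?pi_gt0.
Unshelve. all: by end_near. Qed.
End stieltjes_local.

(** * Stieltjes inversion *)

Section density_measure.
Context (R : realType) (f : R -> R).
Hypotheses (f0 : forall x, 0 <= f x) (mf : measurable_fun setT f).

(** The two proofs are arguments of the definition so that the measure
    structure can be attached to it. *)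
Definition density_measure of (forall x, 0 <= f x) & measurable_fun setT f :=
  fun B : set R => (\int[@lebesgue_measure R]_(x in B) (f x)%:E)%E.

Local Notation nu := (density_measure f0 mf).

Let nu0 : nu set0 = 0%E.
Proof. exact: integral_set0. Qed.

Let nu_ge0 B : (0 <= nu B)%E.
Proof. by apply: integral_ge0 => x _; rewrite lee_fin. Qed.

Let nu_additive : semi_sigma_additive nu.
Proof.
move=> F mF tF mUF; rewrite /density_measure ge0_integral_bigcup//.
- apply: is_cvg_ereal_nneg_natsum_cond => n _ _; exact: nu_ge0.
- by apply/measurable_EFinP; exact: measurable_funTS.
- by move=> x _; rewrite lee_fin.
Qed.

HB.instance Definition _ :=
  isMeasure.Build _ _ _ nu nu0 nu_ge0 nu_additive.

End density_measure.

Section stieltjes_inversion.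
Context (R : realType) (m : {finite_measure set R -> \bar R}).
Local Notation leb := (@lebesgue_measure R).

Lemma poisson_int_fin_num e x : 0 < e -> poisson_int m e x \is a fin_num.
Proof.
move=> e0; apply: integrable_fin_num => //.
apply: (@measurable_bounded_integrable _ _ _ m (fun t => poisson e t x)) => //.
- by rewrite -ge0_fin_numE// fin_num_measure.
- apply: measurable_funM => //.
  by apply: measurable_inv_sqrD; [rewrite gt_eqF|exact: measurable_funB].
exists e^-1; split; first exact: num_real.
move=> N eN t _; apply: le_trans (ltW eN).
rewrite /= ger0_norm ?poisson_ge0// /poisson.
rewrite ler_pdivrMr ?sqrD_sqr_gt0 ?gt_eqF// mulrC ler_pdivlMr//.
by rewrite -expr2 lerDr sqr_ge0.
Qed.

(** The open subintervals of [(p, q)] are stable under intersection and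
    generate its Borel sets. *)
Lemma measure_eq_density_itv (f : R -> R) (p q : R) :
  (forall x, 0 <= f x) -> measurable_fun setT f ->
  (forall a b, p <= a -> a < b -> b <= q ->
    (m `]a, b[%classic = \int[leb]_(x in `[a, b]) (f x)%:E)%E) ->
  forall B, measurable B -> B `<=` `]p, q[%classic ->
    (m B = \int[leb]_(x in B) (f x)%:E)%E.
Proof.
move=> f0 mf Hm B mB BJ.
have mJ : measurable (`]p, q[%classic : set R) by exact: measurable_itv.
pose nu := density_measure f0 mf.
have mE : (@measurable _ R) = <<s @RGenOInfty.G R >>.
  exact: RGenOInfty.measurableE.
suff : mrestr m mJ B = mrestr nu mJ B by rewrite /mrestr setIidl.
apply: (measure_unique (@RGenOInfty.G R) (fun n => `]- n%:R, +oo[%classic) mE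
  _ _ _ (mrestr m mJ) (mrestr nu mJ)) => //.
- move=> _ _ [x ->] [y ->]; exists (Num.max x y).
  apply/seteqP; split => z /=; rewrite !in_itv/= !andbT gt_max.
    by move=> [-> ->].
  by move=> /andP[].
- by move=> n; exists (- n%:R).
- apply/seteqP; split => // x _; exists (Num.bound `|x|) => //=.
  rewrite in_itv/= andbT ltrNl (le_lt_trans (ler_norm _))//.
  by rewrite normrN archi_boundP//.
- move=> _ [x ->].
  suff: m `]Num.max x p, q[%classic = nu `]Num.max x p, q[%classic.
    suff -> : `]Num.max x p, q[%classic = `]x, +oo[%classic `&` `]p, q[%classic.
      exact.
    apply/seteqP; split => z /=; rewrite !in_itv/= gt_max.
      by move=> /andP[/andP[-> ->] ->].
    by move=> [/andP[-> _] /andP[-> ->]].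
  have [ab|ab] := ltP (Num.max x p) q.
    rewrite Hm ?le_max ?lexx ?orbT// /nu /density_measure.
    by rewrite integral_itv_bndo_bndc ?integral_itv_obnd_cbnd//;
      apply/measurable_EFinP; exact: measurable_funTS.
  rewrite set_itv_ge ?bnd_simp -?leNgt//.
  by rewrite measure0 [RHS]measure0.
- by move=> k; rewrite -ge0_fin_numE// fin_num_measure//; apply: measurableI.
Qed.

(** The limit hypothesis bounds the Poisson integrals near each point of [U],
    so [stieltjes_local] applies to all small intervals around it; countably
    many of them, with rational endpoints, cover [U]. *)
Lemma stieltjes_inversion (f : R -> R) (U : set R) : open U ->
  (forall x, 0 <= f x) -> measurable_fun setT f ->
  (forall x0, U x0 -> forall c : R, 0 < c -> exists2 d : R, 0 < d &
    forall x e : R, `|x - x0| < d -> 0 < e < d ->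
      `|fine (poisson_int m e x) - pi * f x0| < c) ->
  forall B, measurable B -> B `<=` U ->
    (m B = \int[leb]_(x in B) (f x)%:E)%E.
Proof.
move=> oU f0 mf Hlim B mB BU.
pose good (pq : rat * rat) := forall C : set R, measurable C ->
  C `<=` `]ratr pq.1, ratr pq.2[%classic -> (m C = \int[leb]_(x in C) (f x)%:E)%E.
have Ugood x0 : U x0 -> exists2 pq, good pq & ratr pq.1 < x0 < ratr pq.2.
  move=> Ux0; have [d d0 Hd] := Hlim x0 Ux0 1 ltr01.
  have /nbhs_ballP[r /= r0 rU] : nbhs x0 U by apply: open_nbhs_nbhs.
  pose s := Num.min d r.
  have s0 : 0 < s by rewrite lt_min d0.
  have xs1 : x0 - s < x0 by rewrite ltrBlDr ltrDl.
  have xs2 : x0 < x0 + s by rewrite ltrDl.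
  have [p] := rat_in_itvoo xs1; rewrite in_itv/= => /andP[p1 p2].
  have [q] := rat_in_itvoo xs2; rewrite in_itv/= => /andP[q1 q2].
  exists (p, q); last by rewrite /= p2 q1.
  apply: (measure_eq_density_itv f0 mf) => a b pa ab bq.
  have near_x0 (x : R) : a <= x <= b -> `|x - x0| < s.
    move=> /andP[ax xb]; rewrite ltr_norml; apply/andP; split.
      by rewrite ltrBrDr addrC; exact: lt_le_trans (lt_le_trans p1 pa) ax.
    by rewrite ltrBlDr addrC; exact: le_lt_trans xb (le_lt_trans bq q2).
  apply: (stieltjes_local (K := pi * f x0 + 1) (d := d)) => //.
  - move=> x xab e ed.
    have xd : `|x - x0| < d by apply: lt_le_trans (near_x0 x xab) _; rewrite ge_min lexx.
    have := Hd x e xd ed; rewrite ltr_norml => /andP[_].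
    rewrite ltrBlDr addrC => /ltW h.
    by rewrite -(fineK (poisson_int_fin_num x _)) ?lee_fin//; case/andP: ed.
  - move=> x xab c c0.
    have Ux : U x.
      apply: rU; rewrite /ball/= distrC; apply: lt_le_trans (near_x0 x xab) _.
      by rewrite ge_min lexx orbT.
    have [d' d'0 Hd'] := Hlim x Ux c c0; exists d' => // e ed.
    by apply: Hd' => //; rewrite subrr normr0.
have [g gK] : exists g : nat -> option (rat * rat),
    forall pq, exists k, g k = Some pq.
  by exists unpickle => pq; exists (pickle pq); exact: pickleK.
pose F k : set R := if g k is Some pq then
  (if `[< good pq >] then `]ratr pq.1, ratr pq.2[%classic else set0) else set0.
have mF k : measurable (F k).
  by rewrite /F; case: (g k) => // pq; case: ifP.
have BF : B = \bigcup_k (B `&` seqDU F k).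
  rewrite -setI_bigcupr -seqDU_bigcup_eq setIidl// => x /BU /Ugood[pq gpq xpq].
  have [k gk] := gK pq; exists k => //; by rewrite /F gk asboolT//= in_itv.
have mBF k : measurable (B `&` seqDU F k).
  by apply: measurableI => //; exact: seqDU_measurable.
have tBF : trivIset setT (fun k => B `&` seqDU F k).
  exact/trivIset_setIl/trivIset_seqDU.
rewrite {1}BF measure_semi_bigcup//; last exact: bigcupT_measurable.
rewrite [in RHS]BF ge0_integral_bigcup//; last 2 first.
- by apply/measurable_EFinP; exact: measurable_funTS.
- by move=> x _; rewrite lee_fin.
apply: eq_eseriesr => k _.
have : B `&` seqDU F k `<=` F k by move=> x [_ h]; exact: subset_seqDU h.
rewrite [X in _ `<=` X]/F; case: (g k) => [pq|]; last first.
  by rewrite subset0 => ->; rewrite measure0 integral_set0.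
case: asboolP => [gpq|_]; first exact: gpq.
by rewrite subset0 => ->; rewrite measure0 integral_set0.
Qed.
End stieltjes_inversion.

(** * Geometric vectors in the Hilbert space *)

Section inner_limits.
Context (R : realType) (H : hilbertType R).
Implicit Types x y : H.

Lemma rdot_CauchySchwarz x y : rdot x y ^+ 2 <= rdot x x * rdot y y.
Proof.
have [y0|] := eqVneq (rdot y y) 0.
  by rewrite y0 (rdot_eq0 y0) /rdot linear0r/= expr0n mulr0.
move=> y_neq0; have y_gt0 : 0 < rdot y y by rewrite lt_def y_neq0 rdot_ge0.
have := rdot_ge0 ((rdot y y)%:C *: x - (rdot x y)%:C *: y).
rewrite !(rdotDl, rdotDr) !(rdotNl, rdotNr) !(rdotZl, rdotZr) (rdotC y x).
rewrite (_ : _ + _ = rdot y y * (rdot x x * rdot y y - rdot x y ^+ 2)).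
  by rewrite pmulr_rge0// subr_ge0.
ring.
Qed.

Lemma lt_complex_norm x (e : R) : 0 < e -> `|x| < e%:C -> rdot x x < e ^+ 2.
Proof.
move=> e0 xe; rewrite -ltcR rdotxxC rmorphXn/=.
by rewrite ltrXn2r// ?nnegrE ?lecR ?ltW.
Qed.

(** By the Cauchy-Schwarz inequality, applied to [x - u n]. *)
Lemma rdot_lim_eq0 (u : nat -> H) x y : u @ \oo --> x ->
  (forall n, rdot (u n) y = 0) -> rdot x y = 0.
Proof.
move=> ux uy; apply/eqP; apply/negP => /negP xy0.
pose e := `|rdot x y| / (1 + rdot y y).
have y1 : 0 < 1 + rdot y y by rewrite ltr_wpDr ?rdot_ge0.
have e0 : 0 < e by rewrite divr_gt0 ?normr_gt0.
have eC0 : (0 : R[i]) < e%:C by rewrite ltcR.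
have /cvgrPdist_lt/(_ _ eC0)[n _ /(_ n (leqnn n))] := ux.
move=> /= /(lt_complex_norm e0) h.
have := rdot_CauchySchwarz (x - u n) y.
rewrite rdotDl rdotNl uy oppr0 addr0 leNgt => /negP; apply.
apply: (@le_lt_trans _ _ (rdot (x - u n) (x - u n) * (1 + rdot y y) ^+ 2)).
  apply: ler_wpM2l; first exact: rdot_ge0.
  have := rdot_ge0 y; nra.
have -> : rdot x y ^+ 2 = e ^+ 2 * (1 + rdot y y) ^+ 2.
  by rewrite -exprMn /e divfK ?gt_eqF// real_normK// num_real.
by rewrite ltr_pM2r// exprn_gt0.
Qed.

End inner_limits.

Section geometric_vector.
Context (R : realType) (H : hilbertType R) (Phi : nat -> H).
Hypothesis onPhi : orthonormal_system Phi.
Implicit Types q : R[i].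

Lemma norm_orthonormal n : `|Phi n| = 1.
Proof.
have /eqP : `|Phi n| ^+ 2 = 1 by rewrite -inner_norm onPhi eqxx.
by rewrite sqrp_eq1// => /eqP.
Qed.

Lemma cvg_geometric_vector q m : `|q| < 1 ->
  cvgn (series (fun j => q ^+ j *: Phi (m + j))).
Proof.
move=> q1; apply/cauchy_cvgP/cauchy_seriesP => e e0.
pose r := complex.Re `|q|.
have qr : `|q| = r%:C by rewrite /r normc_def.
have r0 : 0 <= r by rewrite -lecR -qr normr_ge0.
have r1 : r < 1 by rewrite -ltcR -qr.
have eE : e = (complex.Re e)%:C.
  move: e0; rewrite ltcE => /andP[/eqP]; case: e => a b. by move=> /= ->.
have e0' : 0 < complex.Re e by rewrite -ltcR -eE.
have r1' : `|r| < 1 by rewrite ger0_norm.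
have /cauchy_cvgP/cauchy_seriesP/(_ _ e0') := @is_cvg_geometric_series R 1 r r1'.
apply: filterS => -[n1 n2] /=; rewrite -ltcR -eE; apply: le_lt_trans.
apply: le_trans (ler_norm_sum _ _ _) _.
rewrite ger0_norm; last first.
  by apply: sumr_ge0 => j _; rewrite /geometric/= mul1r exprn_ge0.
rewrite rmorph_sum/= ler_sum// => j _.
by rewrite normrZ norm_orthonormal mulr1 normrX qr /geometric/= mul1r rmorphXn.
Qed.

End geometric_vector.

Section geometric_limits.
Context (R : realType) (H : hilbertType R) (Phi : nat -> H).
Hypothesis onPhi : orthonormal_system Phi.
Implicit Types q : R[i].

(** [rdot x (i y)] is the imaginary part of [<x, y>]. *)
Lemma inner_eq0 (x y : H) : rdot x y = 0 -> rdot x ('i *: y) = 0 ->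
  inner x y = 0.
Proof.
rewrite /rdot innerZr; case: (inner x y) => a b /= -> h.
by apply/eqP; rewrite eq_complex /= eqxx/=; apply/eqP; move: h; lra.
Qed.

Lemma inner_geometric_vector q m k W : (k < m)%N ->
  series (fun j => q ^+ j *: Phi (m + j)) @ \oo --> W -> inner W (Phi k) = 0.
Proof.
move=> km SW.
have S0 n : inner (series (fun j => q ^+ j *: Phi (m + j)) n) (Phi k) = 0.
  rewrite /series/= linear_sumlz/= big1// => j _.
  by rewrite innerZl onPhi gtn_eqF ?mulr0// ltn_addr.
apply: inner_eq0; apply: (rdot_lim_eq0 SW) => n.
  by rewrite /rdot S0.
by rewrite /rdot innerZr S0 mulr0.
Qed.

Lemma geometric_vector_shift q m W W' :
  series (fun j => q ^+ j *: Phi (m + j)) @ \oo --> W ->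
  series (fun j => q ^+ j *: Phi (m.+1 + j)) @ \oo --> W' ->
  W = Phi m + q *: W'.
Proof.
move=> SW SW'.
have : series (fun j => q ^+ j *: Phi (m + j)) n.+1 @[n --> \oo] -->
    Phi m + q *: W'.
  have -> : (fun n => series (fun j => q ^+ j *: Phi (m + j)) n.+1) =
      (fun n => Phi m + q *: series (fun j => q ^+ j *: Phi (m.+1 + j)) n).
    apply/funext => n; rewrite /series/= big_nat_recl//= expr0 scale1r addn0.
    congr (_ + _); rewrite scaler_sumr; apply: eq_bigr => j _.
    by rewrite scalerA exprS addnS addSn.
  by apply: cvgD; [exact: cvg_cst|exact: cvgZr].
have SW1 : series (fun j => q ^+ j *: Phi (m + j)) n.+1 @[n --> \oo] --> W.
  by rewrite (cvg_shiftS (series (fun j => q ^+ j *: Phi (m + j)))).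
by move=> /(cvg_lim (@norm_hausdorff _ _)) <-; rewrite (cvg_lim _ SW1).
Qed.

Lemma geometric_vector_map q (c : R[i]) m m' W W' (B : {linear H -> H}) :
  continuous B ->
  (forall j, B (Phi (m + j)) = c *: Phi (m' + j)) ->
  series (fun j => q ^+ j *: Phi (m + j)) @ \oo --> W ->
  series (fun j => q ^+ j *: Phi (m' + j)) @ \oo --> W' ->
  B W = c *: W'.
Proof.
move=> cB BE SW SW'.
have BS : B (series (fun j => q ^+ j *: Phi (m + j)) n) @[n --> \oo] --> B W.
  by apply: (cvg_comp _ _ SW); exact: cB.
rewrite -(cvg_lim _ BS)//; apply/cvg_lim => //.
have -> : (fun n => B (series (fun j => q ^+ j *: Phi (m + j)) n)) =
    (fun n => c *: series (fun j => q ^+ j *: Phi (m' + j)) n).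
  apply/funext => n; rewrite /series/= linear_sum scaler_sumr.
  by apply: eq_bigr => j _; rewrite linearZ/= BE !scalerA mulrC.
exact: cvgZr.
Qed.

End geometric_limits.

(** * The Green function of the Jacobi matrix *)

Section jacobi_polynomials.
Context (R : realType) (F : comNzRingType) (iota : {rmorphism R -> F}).
Variables (s g o1 o2 : R).
Implicit Types q : F.

(** Elimination of the first coordinates of [(P - z) v = c Phi_0], for
    [z = a + s g (q + 1/q)] and [v] of ratio [q] from index two on. [A0] and
    [A1] are [q] times the differences between [z] and the first two diagonal
    coefficients; the equation at index two makes the coordinates one and two
    proportional to [A2] and [s o2 q]. In the same normalization [num] is the
    coordinate of index zero, and [c = - den / q]. The morphism [iota] makes the same formulas
    available over the reals, over the complex numbers and for formal
    polynomials. *)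
Definition jacobi_A0 q : F := iota (s * g) + iota (g ^+ 2) * q + iota (s * g) * q ^+ 2.
Definition jacobi_A1 q : F :=
  iota (s * g) + iota (g ^+ 2 - o1 ^+ 2) * q + iota (s * g) * q ^+ 2.
Definition jacobi_A2 q : F := iota (s * g) + iota (g ^+ 2 - o2 ^+ 2) * q.
Definition jacobi_num q : F :=
  jacobi_A1 q * jacobi_A2 q - iota (s ^+ 2 * o2 ^+ 2) * q ^+ 2.
Definition jacobi_den q : F :=
  jacobi_A0 q * jacobi_num q - iota (s ^+ 2 * o1 ^+ 2) * q ^+ 2 * jacobi_A2 q.

End jacobi_polynomials.

Section resolvent.
Context (R : realType) (H : hilbertType R) (Phi : nat -> H).
Hypothesis onPhi : orthonormal_system Phi.
Variables (Bp Bm : {linear H -> H}) (s g o1 o2 : R).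
Hypotheses (s_gt0 : 0 < s) (g_gt0 : 0 < g) (o1_gt0 : 0 < o1) (o2_gt0 : 0 < o2).
Hypotheses (cBp : continuous Bp) (cBm : continuous Bm).
Hypotheses (Bp0 : Bp (Phi 0%N) = o1%:C *: Phi 1%N)
  (Bp1 : Bp (Phi 1%N) = o2%:C *: Phi 2%N)
  (Bp2 : forall j, Bp (Phi (2 + j)) = g%:C *: Phi (3 + j)).
Hypotheses (Bm0 : Bm (Phi 0%N) = 0) (Bm1 : Bm (Phi 1%N) = o1%:C *: Phi 0%N)
  (Bm2 : Bm (Phi 2%N) = o2%:C *: Phi 1%N)
  (Bm3 : forall j, Bm (Phi (3 + j)) = g%:C *: Phi (2 + j)).

Let P (x : H) : H := Bp (Bm x + s%:C *: x) + s%:C *: (Bm x + s%:C *: x).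
Let iota : {rmorphism R -> R[i]} := real_complex R.
Let num := jacobi_num iota s g o1 o2.
Let den := jacobi_den iota s g o1 o2.

(** The geometric vector [W] of ratio [q] starting at index two satisfies
    [Bm W = o2 Phi_1 + q g W] and [q Bp W = g (W - Phi_2)], so that [P] acts on
    combinations of [Phi_0], [Phi_1], [Phi_2] and [W], and the equation becomes
    an identity between four coefficients. *)
Lemma jacobi_resolvent_vector (q z : R[i]) : q != 0 -> `|q| < 1 ->
  z * q = (s%:C + g%:C * q) * (s%:C * q + g%:C) ->
  exists v : H, [/\ P v - z *: v = (- (den q / q)) *: Phi 0%N,
    inner v (Phi 0%N) = num q & v != 0].
Proof.
move=> q0 q1 zq.
have [S2 S3] := (cvg_geometric_vector onPhi (m := 2) q1,
                 cvg_geometric_vector onPhi (m := 3) q1).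
set W := limn (series (fun j => q ^+ j *: Phi (2 + j))) in S2.
set W3 := limn (series (fun j => q ^+ j *: Phi (3 + j))) in S3.
have WE : W = Phi 2%N + q *: W3 := geometric_vector_shift S2 S3.
have BpW : Bp W = (g%:C / q) *: W + (- (g%:C / q)) *: Phi 2%N.
  rewrite (geometric_vector_map cBp Bp2 S2 S3) WE.
  by rewrite scalerDr addrAC scaleNr subrr add0r scalerA divfK.
have BmW : Bm W = o2%:C *: Phi 1%N + (q * g%:C) *: W.
  rewrite {1}WE linearD linearZ/= Bm2 (geometric_vector_map cBm Bm3 S3 S2).
  by rewrite scalerA.
pose comb a b c d := a *: Phi 0%N + b *: Phi 1%N + c *: W + d *: Phi 2%N.
have combD a b c d a' b' c' d' :
    comb a b c d + comb a' b' c' d' = comb (a + a') (b + b') (c + c') (d + d').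
  by rewrite /comb !scalerDl [LHS](AC (4*4) ((1*5)*(2*6)*(3*7)*(4*8))).
have combZ k a b c d : k *: comb a b c d = comb (k * a) (k * b) (k * c) (k * d).
  by rewrite /comb !scalerDr !scalerA.
have combN a b c d : - comb a b c d = comb (- a) (- b) (- c) (- d).
  by rewrite -scaleN1r combZ !mulN1r.
have Bmcomb a b c : Bm (comb a b c 0) = comb (o1%:C * b) (o2%:C * c) (q * g%:C * c) 0.
  rewrite /comb !linearD !linearZ/= Bm0 Bm1 BmW scaler0 !scale0r !addr0 add0r.
  by rewrite scalerDr !scalerA addrA ![_ * b]mulrC ![_ * c]mulrC.
have Bpcomb a b c : Bp (comb a b c 0) =
    comb 0 (o1%:C * a) (g%:C / q * c) (o2%:C * b - g%:C / q * c).
  have -> : Bp (comb a b c 0) = a *: Bp (Phi 0%N) + b *: Bp (Phi 1%N) + c *: Bp W.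
    by rewrite /comb scale0r addr0 !linearD !linearZ.
  rewrite /comb Bp0 Bp1 BpW scale0r add0r scalerBl scalerDr !scalerA mulrN scaleNr.
  by rewrite addrACA (mulrC o1%:C) (mulrC (g%:C / q)) (mulrC o2%:C).
(* The coordinates are scaled by [s^2 o1 o2], which clears all denominators. *)
pose v := comb (num q) (s%:C * o1%:C * q * jacobi_A2 iota s g o2 q)
  (s%:C ^+ 2 * o1%:C * o2%:C * q ^+ 2) 0.
exists v; split.
- rewrite /P /v Bmcomb combZ combD mulr0 addr0 Bpcomb combZ combD.
  rewrite combZ combN combD.
  have zE : z = (s%:C + g%:C * q) * (s%:C * q + g%:C) / q.
    by rewrite -zq mulfK.
  have -> : - (den q / q) *: Phi 0%N = comb (- (den q / q)) 0 0 0.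
    by rewrite /comb !scale0r !addr0.
  rewrite zE /den /jacobi_den -/num /jacobi_A0 /num /jacobi_num /jacobi_A1 /jacobi_A2.
  rewrite /iota /= !rmorphB/= !rmorphM/= ?rmorphXn/=.
  congr (comb _ _ _ _); field; exact: q0.
- rewrite /v /comb !innerDl !innerZl !onPhi/= (inner_geometric_vector onPhi _ S2)//.
  by rewrite mulr1 !mulr0 !addr0.
- apply/eqP => v0; have : inner v (Phi 2%N) = 0 by rewrite v0 linear0l.
  rewrite /v /comb !innerDl !innerZl !onPhi/= WE innerDl innerZl.
  rewrite (inner_geometric_vector onPhi _ S3)// onPhi/= !mulr0 !addr0 !add0r mulr1.
  have rC0 (a : R) : 0 < a -> a%:C != 0 by move=> a0; rewrite gt_eqF// ltcR.
  by apply/eqP; rewrite mul0r addr0 !mulf_neq0 ?expf_neq0// rC0.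
Qed.

End resolvent.

(** * The Joukowski parameter *)

Section joukowski.
Context (R : realType).
Implicit Types (q w z : R[i]).

Lemma complex_norm_lt1 q :
  (`|q| < 1) = (complex.Re q ^+ 2 + complex.Im q ^+ 2 < 1).
Proof.
rewrite normc_def -[1]/(1%:C) ltcR -[in LHS]sqrtr1 ltr_sqrt//.
Qed.

Lemma complex_inv_re_im q : q^-1 =
  (complex.Re q / (complex.Re q ^+ 2 + complex.Im q ^+ 2)) -i*
  (complex.Im q / (complex.Re q ^+ 2 + complex.Im q ^+ 2)).
Proof. by case: q => a b. Qed.

Lemma Im_joukowski q : complex.Im (q + q^-1) =
  complex.Im q * (1 - (complex.Re q ^+ 2 + complex.Im q ^+ 2)^-1).
Proof. by rewrite complex_inv_re_im; case: q => a b /=; ring. Qed.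

Lemma complex_norm_sqr_gt0 q : q != 0 -> 0 < complex.Re q ^+ 2 + complex.Im q ^+ 2.
Proof.
case: q => a b; rewrite eq_complex /= negb_and => /orP[a0|b0].
  by rewrite ltr_pwDl ?sqr_ge0// exprn_even_gt0.
by rewrite ltr_wpDl ?sqr_ge0// exprn_even_gt0.
Qed.

Lemma joukowski_Im_lt0 q : q != 0 -> `|q| < 1 -> 0 < complex.Im (q + q^-1) ->
  complex.Im q < 0.
Proof.
move=> q0; rewrite complex_norm_lt1 Im_joukowski => n1.
have n0 := complex_norm_sqr_gt0 q0; rewrite !ltNge; apply: contraNN => h.
by rewrite mulr_ge0_le0// subr_le0 invf_ge1// ltW.
Qed.

(** The two solutions [q] of [q + 1/q = w] are inverse to each other, and
    neither is on the unit circle when [w] is not real. *)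
Lemma joukowski_root w : 0 < complex.Im w ->
  exists q, [/\ q != 0, `|q| < 1, complex.Im q < 0 & q + q^-1 = w].
Proof.
move=> w0.
suff [q [q0 q1 qw]] : exists q, [/\ q != 0, `|q| < 1 & q + q^-1 = w].
  by exists q; split => //; apply: joukowski_Im_lt0 => //; rewrite qw.
pose q := (w + sqrtc (w ^+ 2 - 4)) / 2.
have qE : q * (w - q) = 1.
  have := sqr_sqrtc (w ^+ 2 - 4); rewrite /q; move: (sqrtc _) => r rE.
  rewrite (_ : _ * _ = (w ^+ 2 - r ^+ 2) / 4); last by field.
  by rewrite rE; field.
have q0 : q != 0.
  by apply/eqP => q0; move: qE; rewrite q0 mul0r => /esym/eqP; rewrite oner_eq0.
have Vq : q^-1 = w - q by apply: (mulfI q0); rewrite qE mulfV.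
have qw : q + q^-1 = w by rewrite Vq addrC subrK.
have n0 := complex_norm_sqr_gt0 q0.
have : 0 < complex.Im (q + q^-1) by rewrite qw.
rewrite Im_joukowski; set n := _ + _ in n0 * => h.
have [n1|n1|n1] := ltgtP n 1.
- by exists q; rewrite complex_norm_lt1.
- exists q^-1; rewrite invrK addrC invr_eq0; split => //.
  rewrite complex_norm_lt1 complex_inv_re_im /= -/n.
  rewrite (_ : _ + _ = n^-1) ?invf_lt1//.
  rewrite sqrrN !expr_div_n -mulrDl -/n expr2 invfM mulrA mulfV ?mul1r//.
  by rewrite gt_eqF.
- by move: h; rewrite n1 invr1 subrr mulr0 ltxx.
Qed.

End joukowski.

Section poisson_jacobi.
Context (R : realType) (H : hilbertType R) (Phi : nat -> H).
Hypothesis onPhi : orthonormal_system Phi.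
Variables (Bp Bm : {linear H -> H}) (s g o1 o2 : R).
Hypotheses (s_gt0 : 0 < s) (g_gt0 : 0 < g) (o1_gt0 : 0 < o1) (o2_gt0 : 0 < o2).
Hypotheses (cBp : continuous Bp) (cBm : continuous Bm).
Hypotheses (Bp0 : Bp (Phi 0%N) = o1%:C *: Phi 1%N)
  (Bp1 : Bp (Phi 1%N) = o2%:C *: Phi 2%N)
  (Bp2 : forall j, Bp (Phi (2 + j)) = g%:C *: Phi (3 + j)).
Hypotheses (Bm0 : Bm (Phi 0%N) = 0) (Bm1 : Bm (Phi 1%N) = o1%:C *: Phi 0%N)
  (Bm2 : Bm (Phi 2%N) = o2%:C *: Phi 1%N)
  (Bm3 : forall j, Bm (Phi (3 + j)) = g%:C *: Phi (2 + j)).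

Let P : {linear H -> H} :=
  (Bp \+ (s%:C \*: idfun)) \o (Bm \+ (s%:C \*: idfun)).
Variable (E : pvm H).
Hypothesis EP : is_spectral_measure E P.

Let iota : {rmorphism R -> R[i]} := real_complex R.
Local Notation num := (jacobi_num iota s g o1 o2).
Local Notation den := (jacobi_den iota s g o1 o2).

(** If [(P - z) u = Phi_0], then by [spectral_resolvent] the Poisson integral
    is [e |u|^2], which is the imaginary part of [<u, Phi_0>] because [P] is
    symmetric. A zero of the denominator would make the nonzero vector of
    [jacobi_resolvent_vector] an eigenvector for a nonreal eigenvalue. *)
Lemma poisson_int_jacobi (q : R[i]) (x e : R) : 0 < e -> q != 0 -> `|q| < 1 ->
  (x +i* e) * q = (s%:C + g%:C * q) * (s%:C * q + g%:C) ->
  den q != 0 /\ poisson_int (pvm_measure E (Phi 0%N)) e x =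
    (complex.Im (- (q * num q / den q)))%:E.
Proof.
move=> e0 q0 q1 zq.
have [v [vE v0 vn0]] := jacobi_resolvent_vector onPhi s_gt0 o1_gt0 o2_gt0
  cBp cBm Bp0 Bp1 Bp2 Bm0 Bm1 Bm2 Bm3 q0 q1 zq.
have Im_resolvent (u y : H) : P u - (x +i* e) *: u = y ->
    complex.Im (inner y u) = - e * rdot u u.
  move=> <-; rewrite innerDl -scaleNr innerZl.
  have := spectral_real EP u; case: (inner (P u) u) => a b /= ->.
  have -> : inner u u = (rdot u u)%:C by rewrite rdotxxC inner_norm.
  by rewrite /=; ring.
have dn0 : den q != 0.
  apply/eqP => d0; have := Im_resolvent v 0.
  rewrite [P v - _]vE d0 mul0r oppr0 scale0r linear0l => /(_ erefl) /esym/eqP.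
  rewrite mulf_eq0 oppr_eq0 gt_eqF//= => /eqP/rdot_eq0 v00.
  by rewrite v00 eqxx in vn0.
split => //.
set k := - (den q / q) in vE.
have k0 : k != 0 by rewrite oppr_eq0 mulf_neq0 ?invr_neq0.
have uE : P (k^-1 *: v) - (x +i* e) *: (k^-1 *: v) = Phi 0%N.
  rewrite linearZ/= scalerA [_ * k^-1]mulrC -scalerA -scalerBr [X in _ *: X]vE.
  by rewrite scalerA mulVf// scale1r.
have uu := Im_resolvent _ _ uE.
have := spectral_resolvent EP (lt0r_neq0 e0) (esym uE).
rewrite /poisson_int /poisson.
under [X in _ -> X = _]eq_integral do rewrite EFinM -sqrrN opprB.
rewrite ge0_integralZl//; last 3 first.
- by apply/measurable_EFinP; apply: measurable_inv_sqrD;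
    [rewrite gt_eqF|exact: measurable_funB].
- by move=> t _; rewrite lee_fin invr_ge0 addr_ge0 ?sqr_ge0.
- by rewrite lee_fin ltW.
move=> ->; rewrite -EFinM; congr EFin.
apply: oppr_inj; rewrite -mulNr -uu innerZr innerC v0.
have -> : - (q * num q / den q) = num q / k.
  by rewrite /k invrN mulrN invf_div mulrCA mulrA.
 move: (k^-1) (num q) => [a b] [c d] /=; ring.
Qed.

End poisson_jacobi.

(** * Boundary values of the Green function *)

Section jacobi_continuous.
Context (R : realType) (K : numFieldType) (iota : {rmorphism R -> K}).
Variables (s g o1 o2 : R).

Lemma jacobi_continuous (q0 : K) : jacobi_den iota s g o1 o2 q0 != 0 ->
  {for q0, continuous (fun q : K => - (q * jacobi_num iota s g o1 o2 q /
    jacobi_den iota s g o1 o2 q))}.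
Proof.
move=> d0.
have cstc (a : K) : {for q0, continuous (fun _ : K => a)}.
  exact: cst_continuous.
have idc : {for q0, continuous (fun q : K => q)} by move=> A; exact.
have sqc : {for q0, continuous (fun q : K => q ^+ 2)}.
  exact: (@continuousM K K _ _ _ idc idc).
have c0 : {for q0, continuous (jacobi_A0 iota s g)}.
  apply: (@continuousD K K K); last by apply: (@continuousM K K).
  by apply: (@continuousD K K K) => //; apply: (@continuousM K K).
have c1 : {for q0, continuous (jacobi_A1 iota s g o1)}.
  apply: (@continuousD K K K); last by apply: (@continuousM K K).
  by apply: (@continuousD K K K) => //; apply: (@continuousM K K).
have c2 : {for q0, continuous (jacobi_A2 iota s g o2)}.
  by apply: (@continuousD K K K) => //; apply: (@continuousM K K).
have cn : {for q0, continuous (jacobi_num iota s g o1 o2)}.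
  by apply: (@continuousB K K K); apply: (@continuousM K K).
have cd : {for q0, continuous (jacobi_den iota s g o1 o2)}.
  apply: (@continuousB K K K); apply: (@continuousM K K) => //.
  exact: (@continuousM K K).
apply: (@continuousN K K K); apply: (@continuousM K K).
  exact: (@continuousM K K).
exact: (@continuousV K K).
Qed.

Lemma jacobi_continuous_dist (q0 : K) : jacobi_den iota s g o1 o2 q0 != 0 ->
  let G q := - (q * jacobi_num iota s g o1 o2 q / jacobi_den iota s g o1 o2 q) in
  forall c : K, 0 < c -> exists2 r : K, 0 < r &
    forall q, `|q0 - q| < r -> `|G q0 - G q| < c.
Proof.
move=> d0 G c c0.
have /cvgrPdist_lt/(_ _ c0)/nbhs_ballP[r /= r0 Hr] := jacobi_continuous d0.
by exists r => // q qr; exact: Hr.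
Qed.
End jacobi_continuous.

Section boundary_values.
Context (R : realType) (m : {finite_measure set R -> \bar R}).
Variables (s g : R) (G : R[i] -> R[i]).
Hypotheses (s_gt0 : 0 < s) (g_gt0 : 0 < g).
Hypothesis poissonG : forall (q : R[i]) (x e : R), 0 < e -> q != 0 ->
  `|q| < 1 -> (x +i* e) * q = (s%:C + g%:C * q) * (s%:C * q + g%:C) ->
  poisson_int m e x = (complex.Im (G q))%:E.

Lemma spectral_parameter (q z : R[i]) : q != 0 ->
  (z * q = (s%:C + g%:C * q) * (s%:C * q + g%:C)) <->
  q + q^-1 = (z - (s ^+ 2 + g ^+ 2)%:C) / (s * g)%:C.
Proof.
move=> q0; have sgC : (s * g)%:C != 0 :> R[i].
  by rewrite gt_eqF// ltcR mulr_gt0.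
rewrite rmorphD !rmorphXn/= rmorphM/= in sgC *.
move: sgC; rewrite mulf_eq0 negb_or => /andP[s0 g0].
split => h.
  rewrite (_ : z = (s%:C + g%:C * q) * (s%:C * q + g%:C) / q); last first.
    by rewrite -h mulfK.
  by field; rewrite q0 s0 g0.
have -> : z = (s%:C * g%:C) * (q + q^-1) + (s%:C ^+ 2 + g%:C ^+ 2).
  by rewrite h; field; rewrite s0 g0.
by field.
Qed.

Lemma spectral_parameter_exists (x e : R) : 0 < e ->
  exists q : R[i], [/\ q != 0, `|q| < 1, complex.Im q < 0 &
    (x +i* e) * q = (s%:C + g%:C * q) * (s%:C * q + g%:C)].
Proof.
move=> e0.
have [|q [q0 q1 Iq qw]] := @joukowski_root R
   (((x +i* e) - (s ^+ 2 + g ^+ 2)%:C) / (s * g)%:C).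
  rewrite -fmorphV/= oppr0 addr0 mulr0 add0r.
  by rewrite mulr_gt0// invr_gt0 mulr_gt0.
by exists q; split => //; apply/spectral_parameter.
Qed.

(** Subtracting the equations of [q] and [q0] gives
    [s g (q - q0) (q - 1/q0) = (z - x0) q]. *)
Lemma spectral_parameter_close (q q0 : R[i]) (x e x0 L : R) : 0 < L ->
  q0 != 0 -> `|q| < 1 -> 0 < e ->
  L%:C <= `|q - q0^-1| ->
  (x +i* e) * q = (s%:C + g%:C * q) * (s%:C * q + g%:C) ->
  x0%:C * q0 = (s%:C + g%:C * q0) * (s%:C * q0 + g%:C) ->
  `|q - q0| <= ((`|x - x0| + e) / (s * g * L))%:C.
Proof.
move=> L0 q00 q1 e0 Lq zq zq0.
have key : (s * g)%:C * ((q - q0) * (q - q0^-1)) = ((x - x0) +i* e) * q.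
  have -> : (x - x0) +i* e = (x +i* e) - x0%:C.
    by rewrite /=; congr (_ +i* _); rewrite oppr0 addr0.
  rewrite [RHS]mulrBl zq rmorphM/=.
  have -> : x0%:C = (s%:C + g%:C * q0) * (s%:C * q0 + g%:C) / q0.
    by rewrite -zq0 mulfK.
  by field.
have sg0 : 0 < s * g by rewrite mulr_gt0.
have sgL0 : 0 < s * g * L by rewrite mulr_gt0.
have sgLC : (0 : R[i]) < (s * g * L)%:C by rewrite ltcR.
rewrite rmorphM/= fmorphV/= ler_pdivlMr//.
have nsg : `|(s * g)%:C| = (s * g)%:C :> R[i] by rewrite ger0_norm// lecR ltW.
apply: (@le_trans _ _ (`|q - q0| * ((s * g)%:C * `|q - q0^-1|))).
  by rewrite ler_wpM2l// rmorphM/= ler_wpM2l// lecR ltW.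
rewrite mulrCA -nsg -!normrM key normrM.
apply: (@le_trans _ _ `|(x - x0) +i* e|).
  by rewrite ler_piMr// ltW.
have -> : (x - x0) +i* e = (x - x0)%:C + 'i * e%:C.
  by rewrite /=; congr (_ +i* _); ring.
apply: le_trans (ler_normD _ _) _; rewrite normrM !normc_def /=.
rewrite !expr0n /= expr1n !add0r !addr0 sqrtr1 mul1r !sqrtr_sqr (gtr0_norm e0).
by rewrite rmorphD.
Qed.

(** The hypothesis with [L] says that [q] stays away from the other solution
    [1/q0] of the equation at [x0]; then [spectral_parameter_close] makes [q]
    converge to [q0] when [x + i e] tends to [x0]. *)
Lemma poisson_int_boundary (x0 L : R) (q0 : R[i]) : 0 < L -> q0 != 0 ->
  x0%:C * q0 = (s%:C + g%:C * q0) * (s%:C * q0 + g%:C) ->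
  (forall c : R[i], 0 < c -> exists2 r : R[i], 0 < r &
    forall q, `|q0 - q| < r -> `|G q0 - G q| < c) ->
  (forall q : R[i], `|q| < 1 -> complex.Im q < 0 -> L%:C <= `|q - q0^-1|) ->
  forall c : R, 0 < c -> exists2 d : R, 0 < d &
    forall x e : R, `|x - x0| < d -> 0 < e < d ->
      `|fine (poisson_int m e x) - complex.Im (G q0)| < c.
Proof.
move=> L0 q00 zq0 cG HL c c0.
have cC : (0 : R[i]) < c%:C by rewrite ltcR.
have [r r0 Hr] := cG _ cC.
have rE : r = (complex.Re r)%:C.
  by move: r0; rewrite ltcE => /andP[/eqP]; case: (r) => a b /= ->.
have r0' : 0 < complex.Re r by rewrite -ltcR -rE.
have sgL0 : 0 < s * g * L by rewrite !mulr_gt0.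
exists (complex.Re r * (s * g * L) / 2); first by rewrite divr_gt0// mulr_gt0.
move=> x e xd /andP[e0 ed].
have [q [qn0 q1 Iq zq]] := spectral_parameter_exists x e0.
rewrite (poissonG e0 qn0 q1 zq)/=.
have := spectral_parameter_close L0 q00 q1 e0 (HL q q1 Iq) zq zq0.
move=> qq0.
have : `|q0 - q| < r.
  rewrite distrC; apply: le_lt_trans qq0 _; rewrite rE ltcR ltr_pdivrMr//.
  by rewrite [ltRHS]splitr; apply: ltrD.
move=> /Hr /= h.
rewrite distrC -ltcR; apply: le_lt_trans h.
have -> : complex.Im (G q0) - complex.Im (G q) = complex.Re (- 'i * (G q0 - G q)).
  by case: (G q0) (G q) => [a1 b1] [a2 b2] /=; ring.
apply: le_trans (normc_ge_Re _) _.
by rewrite normrM normrN (_ : `|'i| = 1) ?mul1r// normc_def /= expr0n expr1n add0r sqrtr1.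
Qed.

End boundary_values.

(** * Identities between numerator and denominator *)

Section autocorrelation.
Context (F : fieldType).
Implicit Types (c x q : F).

Definition quartic c0 c1 c2 c3 c4 q : F :=
  c0 + c1 * q + c2 * q ^+ 2 + c3 * q ^+ 3 + c4 * q ^+ 4.

(** [Q(q) Q(1/q)] as a polynomial in [(q + 1/q) / 2], written with Chebyshev
    polynomials. *)
Definition quartic_autocorr c0 c1 c2 c3 c4 : {poly F} :=
  (c0 ^+ 2 + c1 ^+ 2 + c2 ^+ 2 + c3 ^+ 2 + c4 ^+ 2)%:P
  + (2 * (c0 * c1 + c1 * c2 + c2 * c3 + c3 * c4))%:P * 'X
  + (2 * (c0 * c2 + c1 * c3 + c2 * c4))%:P * (2%:P * 'X ^+ 2 - 1%:P)
  + (2 * (c0 * c3 + c1 * c4))%:P * (4%:P * 'X ^+ 3 - 3%:P * 'X)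
  + (2 * (c0 * c4))%:P * (8%:P * 'X ^+ 4 - 8%:P * 'X ^+ 2 + 1%:P).

Lemma quartic_autocorrE c0 c1 c2 c3 c4 q : q != 0 -> (2 : F) != 0 ->
  quartic c0 c1 c2 c3 c4 q * quartic c0 c1 c2 c3 c4 q^-1 =
  (quartic_autocorr c0 c1 c2 c3 c4).[(q + q^-1) / 2].
Proof.
move=> q0 two0.
rewrite /quartic_autocorr !(hornerD, hornerN, hornerM, horner_exp, hornerC, hornerX) /quartic.
by field; rewrite q0 two0.
Qed.
End autocorrelation.

Section jacobi_identities.
Context (R : realType) (K : fieldType) (iota : {rmorphism R -> K}).
Variables (s g o1 o2 : R).
Local Notation num := (jacobi_num iota s g o1 o2).
Local Notation den := (jacobi_den iota s g o1 o2).

(** For [q] on the unit circle [1/q] is the conjugate of [q], and this is the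
    imaginary part of the Green function multiplied by the squared modulus of
    its denominator. *)
Lemma jacobi_wronskian (q : K) : q != 0 ->
  num q^-1 * den q / q - q * num q * den q^-1 =
  iota (s ^+ 5 * g * o1 ^+ 2 * o2 ^+ 2) * (q^-1 - q).
Proof.
move=> q0; rewrite /jacobi_den /jacobi_num /jacobi_A0 /jacobi_A1 /jacobi_A2.
rewrite !rmorphB/= !rmorphM/= ?rmorphXn/=.
by field.
Qed.

End jacobi_identities.

Section jacobi_factorization.
Context (R : realType) (K : numFieldType) (iota : {rmorphism R -> K}).
Variables (s g o1 o2 e : R).
Hypotheses (g2 : g ^+ 2 = e * (2 - e) / 4) (o12 : o1 ^+ 2 = e)
  (o22 : o2 ^+ 2 = e * (1 - e) / 2).

(** Up to the constant [e / 4], the quotient of the denominator by [s + g q].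
    This factor comes from the product form of the operator: a sequence killed
    by [Bm + s] has ratio [q = - s / g] and solves the equation with [z = 0] and
    [c = 0]. *)
Definition qw_quartic (F : fieldType) (iota : {rmorphism R -> F}) (q : F) : F :=
  quartic (iota (s ^+ 2 * (2 - e) * g)) (iota (- (2 * s * g ^+ 2)))
    (iota (- (g * (2 * s ^+ 2 + e ^+ 2 * (2 + e) / 4))))
    (iota (- (s * e ^+ 3 / 2))) (iota (s ^+ 2 * e * g)) q.

Lemma jacobi_den_factor (q : K) : jacobi_den iota s g o1 o2 q =
  iota (e / 4) * (iota s + iota g * q) * qw_quartic iota q.
Proof.
rewrite /jacobi_den /jacobi_num /jacobi_A0 /jacobi_A1 /jacobi_A2 /qw_quartic /quartic.
rewrite o12 o22.
(* With [e = 4 h] the relation on [g] has no division. *)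
pose h := iota (e / 4).
have E4 : iota e = 4 * h.
  by rewrite /h rmorphM/= fmorphV/= rmorph_nat mulrC divfK// pnatr_eq0.
have G2 : iota g ^+ 2 = h * (2 - 4 * h).
  rewrite -rmorphXn/= g2 !rmorphM/= rmorphB/= fmorphV/= !rmorph_nat E4.
  by field.
rewrite -/h !(rmorphB, rmorphD, rmorphN, rmorphM, fmorphV, rmorphXn, rmorph_nat, rmorph1)/=.
rewrite E4; move: (iota s) (iota g) h G2 {E4} => S G h' G2.

field: G2; exact: isT.
Qed.

(** The squared modulus of the denominator at a point of the unit circle, as a
    polynomial in its real part. *)
Definition qw_density_den : {poly R} :=
  ((e / 4) ^+ 2)%:P * ((s ^+ 2 + g ^+ 2)%:P + (2 * s * g)%:P * 'X) *
  quartic_autocorr (s ^+ 2 * (2 - e) * g) (- (2 * s * g ^+ 2))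
    (- (g * (2 * s ^+ 2 + e ^+ 2 * (2 + e) / 4)))
    (- (s * e ^+ 3 / 2)) (s ^+ 2 * e * g).

Lemma quartic_autocorr_rmorph c0 c1 c2 c3 c4 (c : R) :
  (quartic_autocorr (iota c0) (iota c1) (iota c2) (iota c3) (iota c4)).[iota c] =
  iota (quartic_autocorr c0 c1 c2 c3 c4).[c].
Proof.
rewrite /quartic_autocorr !(hornerD, hornerN, hornerM, horner_exp, hornerC, hornerX).
by rewrite !(rmorphB, rmorphD, rmorphN, rmorphM, rmorphXn, rmorph_nat, rmorph1)/=.
Qed.

Lemma jacobi_den_inv (q : K) (c : R) : q != 0 -> (q + q^-1) / 2 = iota c ->
  jacobi_den iota s g o1 o2 q * jacobi_den iota s g o1 o2 q^-1 =
  iota qw_density_den.[c].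
Proof.
move=> q0 qc; rewrite !jacobi_den_factor.
have two0 : (2 : K) != 0 by rewrite pnatr_eq0.
have QQ := quartic_autocorrE (iota (s ^+ 2 * (2 - e) * g))
  (iota (- (2 * s * g ^+ 2)))
  (iota (- (g * (2 * s ^+ 2 + e ^+ 2 * (2 + e) / 4))))
  (iota (- (s * e ^+ 3 / 2))) (iota (s ^+ 2 * e * g)) q0 two0.
rewrite qc quartic_autocorr_rmorph in QQ.
rewrite mulrACA [qw_quartic _ _ * _]QQ /qw_density_den.
set A := quartic_autocorr _ _ _ _ _.
move: (e / 4) => h.
rewrite !(hornerD, hornerM, hornerC, hornerX) [RHS]rmorphM/=; congr (_ * _).
rewrite [RHS]rmorphM/= [iota (h ^+ 2)]rmorphXn/= rmorphD/= [iota (_ * c)]rmorphM/= -qc.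
rewrite rmorphD/= !rmorphXn/= 2!rmorphM/= rmorph_nat.
by field; rewrite q0.
Qed.

End jacobi_factorization.

(** * The denominator at the edges *)

Section edge_values.
Context (R : realType).
Variables (s g e : R).
Hypotheses (s_gt0 : 0 < s) (g_gt0 : 0 < g) (e_gt0 : 0 < e) (e_lt1 : e < 1).
Hypothesis g2 : g ^+ 2 = e * (2 - e) / 4.
Local Notation dens := (qw_density_den s g e).

Lemma quartic_autocorr1 (c0 c1 c2 c3 c4 : R) :
  (quartic_autocorr c0 c1 c2 c3 c4).[1] = quartic c0 c1 c2 c3 c4 1 ^+ 2.
Proof.
rewrite /quartic_autocorr !(hornerD, hornerN, hornerM, horner_exp, hornerC, hornerX).
rewrite /quartic; ring.
Qed.

Lemma quartic_autocorrN1 (c0 c1 c2 c3 c4 : R) :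
  (quartic_autocorr c0 c1 c2 c3 c4).[-1] = quartic c0 c1 c2 c3 c4 (-1) ^+ 2.
Proof.
rewrite /quartic_autocorr !(hornerD, hornerN, hornerM, horner_exp, hornerC, hornerX).
rewrite /quartic; ring.
Qed.

(** The coefficients on the left are those of [(1 + q) (b0 + .. + b3 q^3)], and
    [(1 + q) (1 + 1/q)] is [2 + 2 c]. *)
Lemma quartic_autocorr_root (b0 b1 b2 b3 c : R) :
  (quartic_autocorr b0 (b0 + b1) (b1 + b2) (b2 + b3) b3).[c] =
  (1 + c) * (2 * (quartic_autocorr b0 b1 b2 b3 0).[c]).
Proof.
rewrite /quartic_autocorr !(hornerD, hornerN, hornerM, horner_exp, hornerC, hornerX).
ring.
Qed.

Lemma qw_quarticN1 : qw_quartic s g e (idfun : {rmorphism R -> R}) (-1) =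
  s * (2 * g ^+ 2 + e ^+ 3 / 2) - g * (e ^+ 2 * (2 + e) / 4).
Proof. by rewrite /qw_quartic /quartic /=; field. Qed.

(** In the value of the quartic at 1 the terms in [s^2] cancel, and the others
    are negative. *)
Lemma qw_density_den_gt0_right : 0 < dens.[1].
Proof.
rewrite /qw_density_den !hornerM quartic_autocorr1.
rewrite !(hornerD, hornerM, hornerC, hornerX) mulr1.
have : 0 < g * (e ^+ 2 * (2 + e) / 4).
  by rewrite mulr_gt0// divr_gt0// mulr_gt0 ?exprn_gt0// addr_gt0.
have : 0 < s * e ^+ 3 / 2 by rewrite divr_gt0// mulr_gt0// exprn_gt0.
have : 0 < 2 * s * g ^+ 2 by rewrite !mulr_gt0.
move=> h1 h2 h3; apply: mulr_gt0.
  apply: mulr_gt0; first by rewrite exprn_gt0// divr_gt0.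
  by rewrite !addr_gt0 ?exprn_gt0// !mulr_gt0.
rewrite exprn_even_gt0//=; apply/eqP => h.
move: h; rewrite /quartic => h; nra.
Qed.

Lemma qw_density_den_gt0_left : s != g ->
  qw_quartic s g e (idfun : {rmorphism R -> R}) (-1) != 0 -> 0 < dens.[-1].
Proof.
move=> sg Q0; rewrite /qw_density_den !hornerM quartic_autocorrN1.
rewrite !(hornerD, hornerM, hornerC, hornerX).
apply: mulr_gt0; last by rewrite exprn_even_gt0.
apply: mulr_gt0; first by rewrite exprn_gt0// divr_gt0.
rewrite (_ : s ^+ 2 + g ^+ 2 + 2 * s * g * -1 = (s - g) ^+ 2); last by ring.
by rewrite exprn_even_gt0//= subr_eq0.
Qed.

(** If [s = g] the factor [s + g q] vanishes at [-1] and the quartic does not: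
    its value is [g e (2 - e)^2 / 4]. Otherwise [-1] is a root of the quartic,
    and the cofactor of [1 + q] at [-1] is positive because
    [4 g^2 - e^3 = e (1 - e) (2 + e)]. In both cases the squared modulus has a
    simple zero in [c]. *)
Lemma qw_density_den_root_left :
  s = g \/ qw_quartic s g e (idfun : {rmorphism R -> R}) (-1) = 0 ->
  exists p : {poly R}, (forall c, dens.[c] = (1 + c) * p.[c]) /\ 0 < p.[-1].
Proof.
set c0 := s ^+ 2 * (2 - e) * g; set c1 := - (2 * s * g ^+ 2).
set c2 := - (g * (2 * s ^+ 2 + e ^+ 2 * (2 + e) / 4)).
set c3 := - (s * e ^+ 3 / 2); set c4 := s ^+ 2 * e * g.
have k0 : 0 < (e / 4) ^+ 2 by rewrite exprn_gt0// divr_gt0.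
have e3 : e ^+ 3 < 4 * g ^+ 2.
  rewrite g2; have : 0 < e * (1 - e) * (2 + e).
    by rewrite !mulr_gt0 ?subr_gt0// addr_gt0.
  nra.
have e30 : 0 < e ^+ 3 by rewrite exprn_gt0.
have [sg _|sg] := eqVneq s g.
  exists (((e / 4) ^+ 2)%:P * (2 * s * g)%:P * quartic_autocorr c0 c1 c2 c3 c4).
  split=> [c|].
    rewrite /qw_density_den -/c0 -/c1 -/c2 -/c3 -/c4.
    move: (quartic_autocorr _ _ _ _ _) => p.
    by rewrite !(hornerD, hornerM, hornerC, hornerX) sg; ring.
  rewrite !hornerM !hornerC quartic_autocorrN1; apply: mulr_gt0.
    by rewrite !mulr_gt0.
  have Q0 := qw_quarticN1.
  rewrite exprn_even_gt0//=; rewrite /qw_quartic /= -/c0 -/c1 -/c2 -/c3 -/c4 in Q0.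
  rewrite Q0 sg.
  have -> : g * (2 * g ^+ 2 + e ^+ 3 / 2) - g * (e ^+ 2 * (2 + e) / 4) =
      g * e * (2 - e) ^+ 2 / 4 by rewrite g2; field.
  have e2 : 0 < 2 - e by rewrite subr_gt0 (lt_trans e_lt1)// ltr1n.
  by apply: lt0r_neq0; rewrite divr_gt0// !mulr_gt0// exprn_gt0.
case=> [/eqP|Q0]; first by rewrite (negbTE sg).
have Qk := qw_quarticN1; rewrite Q0 in Qk.
pose b1 := c1 - c0; pose b2 := c2 - b1.
have c1E : c1 = c0 + b1 by rewrite /b1; ring.
have c2E : c2 = b1 + b2 by rewrite /b2; ring.
have c3E : c3 = b2 + c4.
  move: Q0; rewrite /qw_quartic /quartic /= -/c0 -/c1 -/c2 -/c3 -/c4 /b2 /b1.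
  by move=> h; apply/eqP; rewrite -subr_eq0; apply/eqP; rewrite -[RHS]oppr0 -h; ring.
exists (((e / 4) ^+ 2)%:P * ((s ^+ 2 + g ^+ 2)%:P + (2 * s * g)%:P * 'X) *
  (2%:P * quartic_autocorr c0 b1 b2 c4 0)); split=> [c|].
  rewrite /qw_density_den -/c0 -/c1 -/c2 -/c3 -/c4 c1E c2E c3E.
  rewrite hornerM quartic_autocorr_root.
  move: (quartic_autocorr _ _ _ _ _) => p.
  by rewrite !(hornerD, hornerM, hornerC, hornerX); ring.
rewrite !hornerM quartic_autocorrN1 !(hornerD, hornerM, hornerC, hornerX).
apply: mulr_gt0.
  apply: mulr_gt0 => //.
  rewrite (_ : s ^+ 2 + g ^+ 2 + 2 * s * g * -1 = (s - g) ^+ 2); last by ring.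
  by rewrite exprn_even_gt0//= subr_eq0.
apply: mulr_gt0 => //; rewrite exprn_even_gt0//=.
rewrite gt_eqF// /quartic /b2 /b1.
have -> : c0 + (c1 - c0) * -1 + (c2 - (c1 - c0)) * (-1) ^+ 2 + c4 * (-1) ^+ 3 +
    0 * (-1) ^+ 4 = 4 * s ^+ 2 * (1 - e) * g + s * (4 * g ^+ 2 - e ^+ 3) / 2.
  have -> : 4 * s ^+ 2 * (1 - e) * g + s * (4 * g ^+ 2 - e ^+ 3) / 2 =
    4 * s ^+ 2 * (1 - e) * g + 4 * s * g ^+ 2 - (g * (e ^+ 2 * (2 + e) / 4))
    - (s * (2 * g ^+ 2 + e ^+ 3 / 2) - g * (e ^+ 2 * (2 + e) / 4)) by field.
  by rewrite -Qk subr0 /c0 /c1 /c2 /c4; field.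
apply: addr_gt0; first by rewrite !mulr_gt0 ?exprn_gt0 ?subr_gt0.
by rewrite divr_gt0// mulr_gt0// subr_gt0.
Qed.

End edge_values.

(** * Edge behaviour of a square-root density *)

Section divergence.
Context (R : realType) (T : Type) (F : set_system T) {FF : Filter F}.
Implicit Types A B : T -> R.

(** The inverse ratio [B / A] is positive and tends to 0. *)
Lemma cvg_ratio_pinfty A B (l : R) : 0 < l -> A @ F --> l -> B @ F --> 0 ->
  (\near F, 0 < B F) -> A x / B x @[x --> F] --> +oo.
Proof.
move=> l0 Al B0 Bpos.
have Apos : \near F, 0 < A F by apply: (cvgr_gt l).
apply/(gtr0_cvgV0 (f := fun x => A x / B x)).
  by near=> x; apply: divr_gt0; near: x.
have : B x / A x @[x --> F] --> 0.
  by rewrite -(mul0r l^-1); apply: cvgM => //; apply: cvgV; rewrite ?gt_eqF.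
by apply: cvg_trans; apply: near_eq_cvg; near=> x; rewrite /= invf_div.
Unshelve. all: by end_near. Qed.

Lemma cvg_ratio_ninfty A B (l : R) : l < 0 -> A @ F --> l -> B @ F --> 0 ->
  (\near F, 0 < B F) -> A x / B x @[x --> F] --> -oo.
Proof.
move=> l0 Al B0 Bpos; apply/cvgNry.
have -> : - (fun x => A x / B x) = (fun x => - A x / B x).
  by apply/funext => x; rewrite fctE mulNr.
apply: (@cvg_ratio_pinfty _ _ (- l)) => //; first by rewrite oppr_gt0.
exact: cvgN.
Qed.
End divergence.

Section edge_density.
Context (R : realType).
Variables (a w K : R) (p : {poly R}).
Hypotheses (w_gt0 : 0 < w) (K_gt0 : 0 < K).
Hypothesis p_gt0 : forall c, -1 < c < 1 -> 0 < p.[c].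

Let c (x : R) : R := (x - a) / w.

(** Square roots of negative numbers are 0, so this function vanishes outside
    [[a - w, a + w]]. *)
Definition edge_density (x : R) : R :=
  K * Num.sqrt (1 - ((x - a) / w) ^+ 2) / p.[(x - a) / w].

Lemma edge_coordinate x : a - w < x < a + w -> -1 < c x < 1.
Proof.
move=> /andP[x1 x2]; rewrite /c ltr_pdivlMr// ltr_pdivrMr// mulN1r mul1r.
by apply/andP; split; lra.
Qed.

Lemma is_derive_horner (q : {poly R}) (x : R) :
  is_derive x (1 : R) (fun y => q.[y]) q^`().[x].
Proof.
by rewrite derivE derive1E; apply: DeriveDef => //; exact: derivable_horner.
Qed.

(** The derivative is written as a fraction whose numerator has a nonzero
    limit at an edge where [p] does not vanish, while its denominator tends to
    0 from above. *)
Lemma is_derive_edge_density x : a - w < x < a + w ->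
  is_derive x (1 : R) edge_density
    (- (K / w * (c x * p.[c x] + (1 - c x ^+ 2) * p^`().[c x])) /
     (Num.sqrt (1 - c x ^+ 2) * p.[c x] ^+ 2)).
Proof.
move=> /edge_coordinate/[dup] cx /andP[c1 c2].
have pc := p_gt0 cx.
have h0 : 0 < 1 - c x ^+ 2 by nra.
have dc : is_derive x (1 : R) c w^-1.
  by rewrite /c; apply: is_derive_eq; rewrite oppr0 addr0 scaler0 add0r /GRing.scale/= mulr1.
have dh : is_derive x (1 : R) (fun y => 1 - c y ^+ 2) (- (2 * c x * w^-1)).
  by apply: is_derive_eq; rewrite /GRing.scale/=; ring.
have ds : is_derive x (1 : R) (fun y => Num.sqrt (1 - c y ^+ 2))
    ((2 * Num.sqrt (1 - c x ^+ 2))^-1 * - (2 * c x * w^-1)).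
  exact: (@is_derive1_comp R Num.sqrt (fun y => 1 - c y ^+ 2) _ _ _
    (is_derive1_sqrt h0) dh).
have dp : is_derive x (1 : R) (fun y => p.[c y]) (p^`().[c x] / w).
  exact: (@is_derive1_comp R (fun y => p.[y]) c _ _ _
    (is_derive_horner p (c x)) dc).
have dV := @is_deriveV _ (fun y => p.[c y]) x _ _ (lt0r_neq0 pc) dp.
change (is_derive x (1 : R)
  (fun y => K * Num.sqrt (1 - c y ^+ 2) * (p.[c y])^-1)
  (- (K / w * (c x * p.[c x] + (1 - c x ^+ 2) * p^`().[c x])) /
     (Num.sqrt (1 - c x ^+ 2) * p.[c x] ^+ 2))).
apply: is_derive_eq; rewrite /GRing.scale/=.
have sq : Num.sqrt (1 - c x ^+ 2) ^+ 2 = 1 - c x ^+ 2.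
  by rewrite sqr_sqrtr ?ltW.
have s0 : Num.sqrt (1 - c x ^+ 2) != 0 by rewrite gt_eqF// sqrtr_gt0.
move: s0 sq; move: (Num.sqrt _) => r r0 <-.
by field; rewrite r0 !gt_eqF.
Qed.

Let c_cvg (x0 : R) : c x @[x --> x0] --> c x0.
Proof.
apply: cvgM; last exact: cvg_cst.
by apply: cvgB; [exact: cvg_id|exact: cvg_cst].
Qed.

Let horner_cvg (q : {poly R}) (x0 : R) : q.[c x] @[x --> x0] --> q.[c x0].
Proof.
exact: (cvg_comp c (fun y => q.[y]) (c_cvg (x0 := x0)) (@continuous_horner R q (c x0))).
Qed.

Let sqrt_cvg (x0 : R) :
  Num.sqrt (1 - c x ^+ 2) @[x --> x0] --> Num.sqrt (1 - c x0 ^+ 2).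
Proof.
apply: (cvg_comp (fun x => 1 - c x ^+ 2) Num.sqrt _ (@sqrt_continuous R _)).
apply: cvgB; first exact: cvg_cst.
by apply: (@cvgM R R _ _ c c); exact: c_cvg.
Qed.

Let c_right : c (a + w) = 1.
Proof. by rewrite /c addrC addKr divff// gt_eqF. Qed.

Let c_left : c (a - w) = -1.
Proof. by rewrite /c addrC addKr mulNr divff// gt_eqF. Qed.

Let sqrt_pos x : a - w < x < a + w -> 0 < Num.sqrt (1 - c x ^+ 2).
Proof.
by move=> /edge_coordinate/andP[c1 c2]; rewrite sqrtr_gt0; nra.
Qed.

Variable h : R -> R.
Hypothesis hE : {in `]a - w, a + w[, h =1 edge_density}.

Lemma is_derive_edge x : a - w < x < a + w -> is_derive x (1 : R) h
    (- (K / w * (c x * p.[c x] + (1 - c x ^+ 2) * p^`().[c x])) /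
     (Num.sqrt (1 - c x ^+ 2) * p.[c x] ^+ 2)).
Proof.
move=> xI; apply: near_eq_is_derive (is_derive_edge_density xI).
have : x \in `]a - w, a + w[ by rewrite in_itv.
move=> /near_in_itvoo; apply: filterS => y yI; by rewrite hE.
Qed.

Lemma edge_derivable : {in `]a - w, a + w[, forall x, derivable h x 1}.
Proof.
by move=> x; rewrite in_itv/= => xI; have dx := is_derive_edge xI; exact: ex_derive.
Qed.

Let edge_lt : a - w < a + w.
Proof. by move: w_gt0; lra. Qed.

Let right_near : \forall x \near (a + w)^'-, a - w < x < a + w.
Proof.
near=> x; apply/andP; split; near: x; last exact: nbhs_left_lt.
exact: nbhs_left_gt edge_lt.
Unshelve. all: by end_near. Qed.

Let left_near : \forall x \near (a - w)^'+, a - w < x < a + w.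
Proof.
near=> x; apply/andP; split; near: x; first exact: nbhs_right_gt.
exact: nbhs_right_lt edge_lt.
Unshelve. all: by end_near. Qed.

Let num_cvg x0 :
  - (K / w * (c x * p.[c x] + (1 - c x ^+ 2) * p^`().[c x])) @[x --> x0]
  --> - (K / w * (c x0 * p.[c x0] + (1 - c x0 ^+ 2) * p^`().[c x0])).
Proof.
apply: cvgN; apply: cvgM; first exact: cvg_cst.
apply: cvgD; first by apply: cvgM; [exact: c_cvg|exact: horner_cvg].
apply: cvgM; last exact: horner_cvg.
by apply: cvgB; [exact: cvg_cst|apply: (@cvgM R R _ _ c c); exact: c_cvg].
Qed.

Let den_cvg x0 : Num.sqrt (1 - c x ^+ 2) * p.[c x] ^+ 2 @[x --> x0]
  --> Num.sqrt (1 - c x0 ^+ 2) * p.[c x0] ^+ 2.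
Proof.
apply: cvgM; first exact: sqrt_cvg.
by apply: (@cvgM R R _ _ (fun x => p.[c x]) (fun x => p.[c x])); exact: horner_cvg.
Qed.

Let den_pos x : a - w < x < a + w -> 0 < Num.sqrt (1 - c x ^+ 2) * p.[c x] ^+ 2.
Proof.
move=> xI; rewrite mulr_gt0 ?sqrt_pos// exprn_gt0// p_gt0//.
exact: edge_coordinate.
Qed.

Lemma edge_derivative_right : 0 < p.[1] ->
  derive1 h x @[x --> (a + w)^'-] --> -oo.
Proof.
move=> p1.
have := num_cvg (x0 := a + w); move/cvg_at_left_filter.
have := den_cvg (x0 := a + w); move/cvg_at_left_filter.
rewrite c_right expr1n subrr sqrtr0 !mul0r mul1r addr0 => dB dA.
have : - (K / w * p.[1]) < 0 by rewrite oppr_lt0 mulr_gt0// divr_gt0.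
move=> /cvg_ratio_ninfty => /(_ _ _ _ _ _ dA dB) => H.
apply: cvg_trans (H _); last by apply: filterS right_near => x; exact: den_pos.
apply: near_eq_cvg; apply: filterS right_near => x xI /=.
by have dx := is_derive_edge xI; rewrite derive1E derive_val.
Qed.

Lemma edge_derivative_left : 0 < p.[-1] ->
  derive1 h x @[x --> (a - w)^'+] --> +oo.
Proof.
move=> p1.
have := num_cvg (x0 := a - w); move/cvg_at_right_filter.
have := den_cvg (x0 := a - w); move/cvg_at_right_filter.
rewrite c_left sqrrN expr1n subrr sqrtr0 !mul0r mulN1r addr0 mulrN opprK => dB dA.
have : 0 < K / w * p.[-1] by rewrite mulr_gt0// divr_gt0.
move=> /cvg_ratio_pinfty => /(_ _ _ _ _ _ dA dB) => H.
apply: cvg_trans (H _); last by apply: filterS left_near => x; exact: den_pos.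
apply: near_eq_cvg; apply: filterS left_near => x xI /=.
by have dx := is_derive_edge xI; rewrite derive1E derive_val.
Qed.

Let sqrt_factor x : a - w < x < a + w -> Num.sqrt (1 - c x ^+ 2) =
  Num.sqrt (x - (a - w)) * Num.sqrt ((1 - c x) / w).
Proof.
move=> /andP[x1 x2]; rewrite -sqrtrM; last by rewrite subr_ge0 ltW.
by congr Num.sqrt; rewrite /c; field; rewrite gt_eqF.
Qed.

Let factor_cvg : Num.sqrt ((1 - c x) / w) @[x --> (a - w)^'+] --> Num.sqrt (2 / w).
Proof.
apply: cvg_at_right_filter.
have -> : 2 / w = (1 - c (a - w)) / w by rewrite c_left opprK.
apply: (cvg_comp (fun x => (1 - c x) / w) Num.sqrt _ (@sqrt_continuous R _)).
apply: cvgM; last exact: cvg_cst.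
by apply: cvgB; [exact: cvg_cst|exact: c_cvg].
Qed.

Lemma edge_power_left : 0 < p.[-1] -> exists C : R, 0 < C /\
  h x / (C * (x - (a - w)) `^ (2^-1)) @[x --> (a - w)^'+] --> (1 : R).
Proof.
move=> p1; pose C := K * Num.sqrt (2 / w) / p.[-1].
have C0 : 0 < C by rewrite divr_gt0// mulr_gt0// sqrtr_gt0 divr_gt0.
exists C; split => //.
have : K * Num.sqrt ((1 - c x) / w) / p.[c x] / C @[x --> (a - w)^'+] --> C / C.
  apply: cvgM; last exact: cvg_cst.
  apply: cvgM; first by apply: cvgM; [exact: cvg_cst|exact: factor_cvg].
  apply: cvgV; first by rewrite gt_eqF.
  by rewrite -c_left; apply: cvg_at_right_filter; exact: horner_cvg.
rewrite divff ?gt_eqF//; apply: cvg_trans.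
apply: near_eq_cvg; apply: filterS left_near => x xI.
have pc := p_gt0 (edge_coordinate xI).
have /andP[x1 x2] := xI.
rewrite hE ?in_itv//= /edge_density -/(c x) sqrt_factor// powR12_sqrt; last first.
  by rewrite subr_ge0 ltW.
have : 0 < Num.sqrt (x - (a - w)) by rewrite sqrtr_gt0 subr_gt0.
move: (Num.sqrt (x - _)) => y y0; field.
by rewrite !gt_eqF.
Qed.

Variable p1 : {poly R}.
Hypothesis pE : forall y, p.[y] = (1 + y) * p1.[y].
Hypothesis p1_gt0 : 0 < p1.[-1].

Let deriv_root y : p^`().[y] = p1.[y] + (1 + y) * p1^`().[y].
Proof.
have d := is_derive_horner p y; rewrite -[LHS](@derive_val _ _ _ _ _ _ _ d).
rewrite (_ : (fun y => p.[y]) = (fun y => (1 + y) * p1.[y])); last first.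
  exact/funext.
have d1 := is_derive_horner p1 y.
have d2 : is_derive y (1 : R) (fun y => (1 + y) * p1.[y])
    (p1.[y] + (1 + y) * p1^`().[y]).
  by apply: is_derive_eq; rewrite /GRing.scale/=; ring.
by rewrite derive_val.
Qed.

Let p1_pos x : a - w < x < a + w -> 0 < p1.[c x].
Proof.
move=> /edge_coordinate/[dup] cI /andP[c1 _]; have := p_gt0 cI.
by rewrite pE pmulr_rgt0//; lra.
Qed.

(** When [p = (1 + y) p1], the numerator of the derivative has the factor
    [1 + c x]; once it is cancelled the numerator tends to
    [- K / w * p1.[-1]], which reverses the sign found in
    [edge_derivative_left]. *)
Lemma edge_derivative_left_root : derive1 h x @[x --> (a - w)^'+] --> -oo.
Proof.
pose A x := - (K / w * (c x * p1.[c x] +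
  (1 - c x) * (p1.[c x] + (1 + c x) * p1^`().[c x]))).
pose B x := Num.sqrt (1 - c x ^+ 2) * (1 + c x) * p1.[c x] ^+ 2.
have onec : 1 + c x @[x --> a - w] --> 1 + c (a - w).
  by apply: cvgD; [exact: cvg_cst|exact: c_cvg].
have onec' : 1 - c x @[x --> a - w] --> 1 - c (a - w).
  by apply: cvgB; [exact: cvg_cst|exact: c_cvg].
have dA : A x @[x --> (a - w)^'+] --> - (K / w * p1.[-1]).
  have -> : - (K / w * p1.[-1]) = A (a - w) by rewrite /A c_left; congr (- _); ring.
  apply: cvg_at_right_filter; apply: cvgN; apply: cvgM; first exact: cvg_cst.
  apply: cvgD; first by apply: cvgM; [exact: c_cvg|exact: horner_cvg].
  apply: cvgM => //; apply: cvgD; first exact: horner_cvg.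
  by apply: cvgM => //; exact: horner_cvg.
have dB : B x @[x --> (a - w)^'+] --> 0.
  have -> : 0 = B (a - w) by rewrite /B c_left subrr mulr0 mul0r.
  apply: cvg_at_right_filter; apply: cvgM.
    by apply: cvgM => //; exact: sqrt_cvg.
  by apply: (@cvgM R R _ _ (fun x => p1.[c x]) (fun x => p1.[c x])); exact: horner_cvg.
have A0 : - (K / w * p1.[-1]) < 0 by rewrite oppr_lt0 mulr_gt0// divr_gt0.
apply: cvg_trans (cvg_ratio_ninfty A0 dA dB _); last first.
  apply: filterS left_near => x xI; have /andP[c1 _] := edge_coordinate xI.
  rewrite /B mulr_gt0 ?exprn_gt0 ?p1_pos// mulr_gt0 ?sqrt_pos//.
  by move: c1; rewrite -subr_gt0 opprK addrC.
apply: near_eq_cvg; apply: filterS left_near => x xI /=.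
have dx := is_derive_edge xI; rewrite derive1E derive_val.
rewrite deriv_root pE /A /B.
have s0 := sqrt_pos xI; have q0 := p1_pos xI.
have c10 : 0 < 1 + c x.
  by have /andP[c1 _] := edge_coordinate xI; move: c1; rewrite -subr_gt0 opprK addrC.
move: s0 q0 c10.
move: (Num.sqrt (1 - c x ^+ 2)) (horner p1 (c x)) (horner p1^`() (c x)) => S Q Q1.
move: (c x) => y S0 Q0 y0.
by field; rewrite !gt_eqF.
Qed.

Lemma edge_power_left_root : exists C : R, 0 < C /\
  h x / (C * (x - (a - w)) `^ (- 2^-1)) @[x --> (a - w)^'+] --> (1 : R).
Proof.
pose C := K * w * Num.sqrt (2 / w) / p1.[-1].
have C0 : 0 < C by rewrite divr_gt0// mulr_gt0 ?sqrtr_gt0 ?divr_gt0// mulr_gt0.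
exists C; split => //.
have : K * w * Num.sqrt ((1 - c x) / w) / p1.[c x] / C @[x --> (a - w)^'+] --> C / C.
  apply: cvgM; last exact: cvg_cst.
  apply: cvgM; first by apply: cvgM; [exact: cvg_cst|exact: factor_cvg].
  apply: cvgV; first by rewrite gt_eqF.
  by rewrite -c_left; apply: cvg_at_right_filter; exact: horner_cvg.
rewrite divff ?gt_eqF//; apply: cvg_trans.
apply: near_eq_cvg; apply: filterS left_near => x xI.
have pc := p1_pos xI.
have /andP[x1 x2] := xI.
rewrite hE ?in_itv//= /edge_density -/(c x) sqrt_factor// powRN powR12_sqrt; last first.
  by rewrite subr_ge0 ltW.
have y0 : 0 < Num.sqrt (x - (a - w)) by rewrite sqrtr_gt0 subr_gt0.
have -> : p.[c x] = Num.sqrt (x - (a - w)) ^+ 2 / w * p1.[c x].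
  rewrite pE sqr_sqrtr ?subr_ge0 ?ltW//; congr (_ * _).
  by rewrite /c; field; rewrite gt_eqF.
move: (Num.sqrt (x - _)) y0 => y y0; field.
by rewrite !gt_eqF.
Qed.

End edge_density.

(** * Uniqueness of a continuous density *)

Section ac_density_unique.
Context (R : realType) (mu : {finite_measure set R -> \bar R}).
Local Notation leb := (@lebesgue_measure R).

(** Off a Lebesgue-null set carrying the two singular parts, both densities
    have the same integrals over all Borel sets. *)
Lemma ac_density_ae_unique (f g : R -> R) :
  is_ac_density mu f -> is_ac_density mu g ->
  {ae leb, forall x, f x = g x}.
Proof.
move=> [mf f0 [nu1 [[N1 [mN1 lN1 nN1]] fE]]] [mg g0 [nu2 [[N2 [mN2 lN2 nN2]] gE]]].
pose D := ~` (N1 `|` N2).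
have mD : measurable D by apply: measurableC; exact: measurableU.
have null (nu : {measure set R -> \bar R}) N B : measurable N ->
    measurable B -> nu (~` N) = 0%E -> B `<=` ~` N -> nu B = 0%E.
  move=> mN mB nN BN; apply/eqP; rewrite eq_le measure_ge0 andbT -nN.
  by rewrite le_measure// ?inE//; exact: measurableC.
have fD B : measurable B -> B `<=` D -> mu B = (\int[leb]_(x in B) (f x)%:E)%E.
  move=> mB BD; rewrite fE// (null _ N1)// ?adde0//.
  by move=> x /BD h Nx; apply: h; left.
have gD B : measurable B -> B `<=` D -> mu B = (\int[leb]_(x in B) (g x)%:E)%E.
  move=> mB BD; rewrite gE// (null _ N2)// ?adde0//.
  by move=> x /BD h Nx; apply: h; right.
have mfD : measurable_fun D (EFin \o f).
  by apply/measurable_EFinP; exact: measurable_funTS.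
have mgD : measurable_fun D (EFin \o g).
  by apply/measurable_EFinP; exact: measurable_funTS.
have intf : leb.-integrable D (EFin \o f).
  apply/integrableP; split => //.
  under eq_integral do rewrite gee0_abs ?lee_fin//.
  by rewrite -fD// -ge0_fin_numE// fin_num_measure.
have [A [mA lA DA]] : ae_eq leb D (EFin \o f) (EFin \o g).
  apply: integral_ae_eq => // B BD mB.
  by rewrite -fD// -gD.
exists (A `|` (N1 `|` N2)); split.
- by apply: measurableU => //; exact: measurableU.
- apply/eqP; rewrite eq_le measure_ge0 andbT -(adde0 0%E) -{1}lA.
  rewrite (le_trans (measureU2 _ _ _))//; first exact: measurableU.
  by rewrite leeD2l// -(adde0 0%E) -{1}lN1 -lN2 measureU2.
- move=> x /= fgx; have [Nx|Nx] := pselect ((N1 `|` N2) x); first by right.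
  by left; apply: DA => /= h; apply: fgx; have [] := h Nx.
Qed.

(** Two continuous functions that differ at a point differ on an interval, and
    an interval has positive Lebesgue measure. *)
Lemma ae_eq_continuous (a b : R) (f g : R -> R) :
  {ae leb, forall x, f x = g x} ->
  {in `]a, b[, continuous f} -> {in `]a, b[, continuous g} ->
  {in `]a, b[, f =1 g}.
Proof.
move=> [A [mA lA fgA]] cf cg x xI; apply/eqP/negPn/negP => fgx.
have : \forall y \near x, f y - g y != 0.
  have : f y - g y @[y --> x] --> f x - g x by apply: cvgB; [exact: cf|exact: cg].
  move/cvgr_neq0; apply; by rewrite subr_eq0.
move=> /nbhs_ballP[r /= r0 Hr].
pose J := `]x - r, x + r[%classic : set R.
have BA : J `<=` A.
  move=> y; rewrite /J /= in_itv/= => /andP[y1 y2]; apply: fgA => /= fgy.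
  have : ball x r y by rewrite /ball/= ltr_norml; apply/andP; split; lra.
  by move=> /Hr; rewrite /= fgy subrr eqxx.
have : (leb J <= leb A)%E.
  by apply: le_measure => //; rewrite inE; [exact: measurable_itv|exact: mA].
rewrite [leb A]lA lebesgue_measure_itv/= lte_fin.
rewrite ifT; last by lra.
by rewrite -EFinB lee_fin leNgt => /negP; apply; lra.
Qed.

End ac_density_unique.

(** * The density of the spectral distribution *)

Section measurable_inverse.
Context (R : realType).

(** The inverse is the pointwise limit of [y / (y^2 + d^2)], also at 0, where
    it is 0 by convention. *)
Lemma measurable_invr : measurable_fun setT (@GRing.inv R).
Proof.
pose u n (y : R) := y * (y ^+ 2 + (n.+1%:R^-1) ^+ 2)^-1.
apply: (measurable_fun_cvg (h := u)).
  move=> n; apply: measurable_funM => //; apply: measurable_inv_sqrD;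
    [by rewrite invr_eq0 pnatr_eq0|exact: measurable_id].
move=> y _; have [->|y0] := eqVneq y 0.
  by rewrite invr0 /u; under eq_fun do rewrite mul0r; exact: cvg_cst.
have -> : y^-1 = y * (y ^+ 2 + 0 ^+ 2)^-1 by field; rewrite y0.
apply: cvgM; first exact: cvg_cst.
apply: cvgV; first by rewrite expr0n addr0 expf_neq0.
apply: cvgD; first exact: cvg_cst.
by apply: (@cvgM R nat _ _ (fun n => n.+1%:R^-1) (fun n => n.+1%:R^-1));
  exact: cvg_harmonic.
Qed.

End measurable_inverse.

Section spectral_parameter_boundary.
Context (R : realType).
Implicit Types (c y : R) (q : R[i]).

Lemma unit_circle_inv c y : c ^+ 2 + y ^+ 2 = 1 ->
  [/\ (c -i* y) != 0 :> R[i], (c -i* y)^-1 = c +i* y :> R[i] &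
   (c -i* y) + (c -i* y)^-1 = (2 * c)%:C].
Proof.
move=> cy; have Vq : (c -i* y)^-1 = c +i* y :> R[i].
  by rewrite complex_inv_re_im /= sqrrN cy !divr1 opprK.
split => //; last first.
  by rewrite Vq; apply/eqP; rewrite eq_complex /=; apply/andP; split; apply/eqP; ring.
apply/eqP => -[c0 /eqP]; rewrite oppr_eq0 => /eqP y0.
by move: cy; rewrite c0 y0 expr0n addr0 => /esym/eqP; rewrite oner_eq0.
Qed.

(** [1/q0] is the conjugate of [q0] and lies in the upper half-plane, at height
    [y]. *)
Lemma unit_circle_dist c y q : c ^+ 2 + y ^+ 2 = 1 -> 0 < y ->
  complex.Im q < 0 -> y%:C <= `|q - (c -i* y)^-1|.
Proof.
move=> cy y0 q0; have [_ -> _] := unit_circle_inv cy.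
have -> : y%:C <= `|q - (c +i* y)| = (y%:C <= `|'i * (q - (c +i* y))|).
  by rewrite normrM (_ : `|'i| = 1) ?mul1r// normc_def /= expr0n expr1n add0r sqrtr1.
apply: le_trans (normc_ge_Re _); rewrite lecR.
case: q q0 => a b /= b0; rewrite ger0_norm; lra.
Qed.

Lemma real_spectral_parameter c : 1 < `|c| -> exists r : R,
  [/\ r != 0, `|r| < 1 & r + r^-1 = 2 * c].
Proof.
wlog c0 : c / 0 < c.
  move=> wl c1; have [cn|cp|c0] := ltgtP c 0.
  - have [||r [r0 r1 rc]] := wl (- c); rewrite ?oppr_gt0 ?normrN//.
    exists (- r); rewrite oppr_eq0 normrN; split => //.
    by rewrite invrN -opprD rc mulrN opprK.
  - exact: wl.
  - by move: c1; rewrite c0 normr0 ltNge ler01.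
rewrite gtr0_norm// => c1; pose y := Num.sqrt (c ^+ 2 - 1).
have c2 : 0 < c ^+ 2 - 1 by nra.
have y2 : y ^+ 2 = c ^+ 2 - 1 by rewrite sqr_sqrtr// ltW.
have y0 : 0 < y by rewrite sqrtr_gt0.
have r0 : 0 < c - y by nra.
exists (c - y); split; first by rewrite gt_eqF.
  by rewrite gtr0_norm//; nra.
have -> : (c - y)^-1 = c + y.
  apply: (@mulfI _ (c - y)); first by rewrite gt_eqF.
  by rewrite mulfV ?gt_eqF// -subr_sqr y2; ring.
ring.
Qed.

Lemma complex_norm_real (r : R) : `|r%:C| = `|r|%:C :> R[i].
Proof. by rewrite normc_def /= expr0n addr0 sqrtr_sqr. Qed.

Lemma real_dist (r : R) q : r != 0 -> `|q| < 1 ->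
  (`|r|^-1 - 1)%:C <= `|q - (r%:C)^-1|.
Proof.
move=> r0 q1; rewrite distrC; apply: le_trans (lerB_dist _ _).
rewrite rmorphB/= lerB//; last exact: ltW.
by rewrite normfV complex_norm_real fmorphV.
Qed.

End spectral_parameter_boundary.

(** With [N'] and [D'] the values at [1/q], the left-hand side is, on the unit
    circle, the difference of the Green function and its conjugate, and the
    right-hand side contains the left-hand side of [jacobi_wronskian]. *)
Lemma green_difference (K : fieldType) (q N N' D D' : K) :
  q != 0 -> D != 0 -> D' != 0 ->
  - (q * N / D) - - (q^-1 * N' / D') = (N' * D / q - q * N * D') / (D * D').
Proof. by move=> q0 D0 D0'; field; rewrite q0 D0 D0'. Qed.

Section jacobi_rmorph.
Context (R : realType) (K L : comNzRingType).
Context (iota : {rmorphism R -> K}) (iota' : {rmorphism R -> L}).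
Variables (sigma : {rmorphism K -> L}) (s g o1 o2 : R).
Hypothesis sigmaE : forall x, sigma (iota x) = iota' x.

Lemma jacobi_num_rmorph q :
  sigma (jacobi_num iota s g o1 o2 q) = jacobi_num iota' s g o1 o2 (sigma q).
Proof.
rewrite /jacobi_num /jacobi_A1 /jacobi_A2.
by rewrite !(rmorphB sigma, rmorphD sigma, rmorphXn sigma, rmorphM sigma) !sigmaE.
Qed.

Lemma jacobi_den_rmorph q :
  sigma (jacobi_den iota s g o1 o2 q) = jacobi_den iota' s g o1 o2 (sigma q).
Proof.
rewrite /jacobi_den (rmorphB sigma) !(rmorphM sigma) jacobi_num_rmorph.
rewrite /jacobi_A0 /jacobi_A2.
by rewrite !(rmorphB sigma, rmorphD sigma, rmorphXn sigma, rmorphM sigma) !sigmaE.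
Qed.

End jacobi_rmorph.

Section spectral_density.
Context (R : realType) (m : {finite_measure set R -> \bar R}).
Variables (s g o1 o2 e : R).
Hypotheses (s_gt0 : 0 < s) (g_gt0 : 0 < g) (o1_gt0 : 0 < o1) (o2_gt0 : 0 < o2).
Hypotheses (g2 : g ^+ 2 = e * (2 - e) / 4) (o12 : o1 ^+ 2 = e)
  (o22 : o2 ^+ 2 = e * (1 - e) / 2).
Let iota : {rmorphism R -> R[i]} := real_complex R.
Local Notation num := (jacobi_num iota s g o1 o2).
Local Notation den := (jacobi_den iota s g o1 o2).
Hypothesis m_poisson : forall (q : R[i]) (x e : R), 0 < e -> q != 0 ->
  `|q| < 1 -> (x +i* e) * q = (s%:C + g%:C * q) * (s%:C * q + g%:C) ->
  poisson_int m e x = (complex.Im (- (q * num q / den q)))%:E.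

Let a : R := s ^+ 2 + g ^+ 2.
Let w : R := 2 * (s * g).
Let k : R := s ^+ 5 * g * o1 ^+ 2 * o2 ^+ 2.
Local Notation dens := (qw_density_den s g e).
Local Notation leb := (@lebesgue_measure R).

Let w_gt0 : 0 < w. Proof. by rewrite !mulr_gt0. Qed.
Let k_gt0 : 0 < k. Proof. by rewrite !mulr_gt0 ?exprn_gt0. Qed.

Let jacobi_num_conj (q : R[i]) : (num q)^*%C = num (q^*%C).
Proof. exact: (jacobi_num_rmorph (sigma := conjc) s g o1 o2 (@conjc_real R)). Qed.

Let jacobi_den_conj (q : R[i]) : (den q)^*%C = den (q^*%C).
Proof. exact: (jacobi_den_rmorph (sigma := conjc) s g o1 o2 (@conjc_real R)). Qed.

(** On the unit circle [1/q] is the conjugate of [q]. If the denominator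
    vanished at [q] it would also vanish at [1/q], and the right-hand side of
    [jacobi_wronskian] would be 0; so its squared modulus is positive, and the
    same identity gives the imaginary part of the Green function. *)
Lemma jacobi_boundary (c y : R) : c ^+ 2 + y ^+ 2 = 1 -> 0 < y ->
  let q := c -i* y in
  [/\ den q != 0, 0 < dens.[c] &
    complex.Im (- (q * num q / den q)) = k * y / dens.[c]].
Proof.
move=> cy y0 q; have [q0 Vq qV] := unit_circle_inv cy; rewrite -/q in q0 Vq qV.
have qJ : q^*%C = q^-1 by rewrite Vq /= opprK.
have wr := jacobi_wronskian iota s g o1 o2 q0.
have qq : q^-1 - q = 2 * y%:C * 'i%C.
  by rewrite Vq; apply/eqP; rewrite eq_complex /=; apply/andP; split; apply/eqP; ring.
have d0 : den q != 0.
  apply/eqP => d0; have d0' : den q^-1 = 0 by rewrite -qJ -jacobi_den_conj d0 conjc0.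
  move: wr; rewrite d0 d0' mulr0 mul0r mulr0 subr0 qq => /esym/eqP.
  have kC : iota k != 0 by rewrite gt_eqF// ltcR.
  have yC : y%:C != 0 :> R[i] by rewrite gt_eqF// ltcR.
  have iC : 'i%C != 0 :> R[i] by rewrite eq_complex /= oner_eq0 andbF.
  by rewrite !mulf_eq0 (negbTE kC) (negbTE yC) (negbTE iC) pnatr_eq0.
have qc : (q + q^-1) / 2 = iota c.
  by rewrite qV rmorphM/= rmorph_nat mulrAC divff ?mul1r// pnatr_eq0.
have dd : den q * den q^-1 = iota dens.[c] by exact: jacobi_den_inv.
have dens0 : 0 < dens.[c].
  rewrite -ltcR -[X in _ < X]dd -qJ -jacobi_den_conj -sqr_normc exprn_gt0//.
  by rewrite normr_gt0.
split => //; apply: complexI; apply: (@mulfI _ (2 * 'i%C)).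
  by rewrite mulf_neq0 ?pnatr_eq0// eq_complex /= oner_eq0 andbF.
have zJ : (- (q * num q / den q))^*%C = - (q^-1 * num q^-1 / den q^-1).
  transitivity (- (q^*%C * (num q)^*%C / (den q)^*%C)).
    by rewrite rmorphN fmorph_div rmorphM.
  by rewrite jacobi_num_conj jacobi_den_conj qJ.
rewrite mulrAC -subcJ zJ.
have d0' : den q^-1 != 0 by rewrite -qJ -jacobi_den_conj conjc_eq0.
have -> : 2 * 'i%C * (k * y / dens.[c])%:C = iota k * (q^-1 - q) / (den q * den q^-1).
  by rewrite dd qq /iota /= fmorph_div/= rmorphM/=; ring.
by rewrite -[iota k * _]wr; exact: green_difference.
Qed.

Lemma qw_density_den_gt0 c : -1 < c < 1 -> 0 < dens.[c].
Proof.
move=> /andP[c1 c2]; have c0 : 0 < 1 - c ^+ 2 by nra.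
have y0 : 0 < Num.sqrt (1 - c ^+ 2) by rewrite sqrtr_gt0.
have cy : c ^+ 2 + Num.sqrt (1 - c ^+ 2) ^+ 2 = 1.
  by rewrite sqr_sqrtr ?ltW// addrC subrK.
by have [] := jacobi_boundary cy y0.
Qed.

Definition spectral_density : R -> R := edge_density a w (k / pi) dens.

Lemma spectral_density_ge0 x : 0 <= spectral_density x.
Proof.
rewrite /spectral_density /edge_density.
have [h|h] := leP (1 - ((x - a) / w) ^+ 2) 0.
  by rewrite ler0_sqrtr// mulr0 mul0r.
apply: divr_ge0.
  by rewrite mulr_ge0// divr_ge0 ?pi_ge0// ltW.
apply: ltW; apply: qw_density_den_gt0; move: h; move: (_ / w) => c c0.
by apply/andP; split; nra.
Qed.

Lemma measurable_spectral_density : measurable_fun setT spectral_density.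
Proof.
have mc : measurable_fun setT (fun x : R => (x - a) / w).
  by apply: measurable_funM => //; exact: measurable_funB.
apply: measurable_funM.
  apply: measurable_funM => //; apply: measurableT_comp.
    exact: continuous_measurable_fun (@sqrt_continuous R).
  by apply: measurable_funB => //; exact: (measurable_funX 2).
apply: (measurableT_comp (@measurable_invr R)).
apply: (@measurableT_comp _ _ _ _ _ _ (horner dens)) => //.
exact: continuous_measurable_fun (@continuous_horner R dens).
Qed.

Lemma spectral_density_eq0 x : ~ (a - w <= x <= a + w) -> spectral_density x = 0.
Proof.
move=> xI; rewrite /spectral_density /edge_density ler0_sqrtr ?mulr0 ?mul0r//.
have : 1 < `|(x - a) / w|.
  rewrite normrM normfV (gtr0_norm w_gt0) ltr_pdivlMr// mul1r ltNge ler_norml.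
  by apply/negP => /andP[x1 x2]; apply: xI; apply/andP; split; lra.
move=> h; rewrite subr_le0 -[leRHS]real_normK ?num_real//.
by rewrite expr_ge1// ltW.
Qed.
(** The two edges, and the points that come from real roots of the denominator:
    these include all poles of the Green function outside the spectral
    interval. *)
Definition exceptional_points : set R :=
  [set a - w; a + w] `|`
  [set s ^+ 2 + g ^+ 2 + s * g * (r + r^-1) |
    r in [set` polyrcf.rootsR (jacobi_den polyC s g o1 o2 'X)]].

Lemma finite_exceptional_points : finite_set exceptional_points.
Proof.
rewrite finite_setU; split; first exact: finite_set2.
by apply: finite_image; exact: finite_seq.
Qed.

Let in_exceptional (r : R) : jacobi_den idfun s g o1 o2 r = 0 ->
  exceptional_points (s ^+ 2 + g ^+ 2 + s * g * (r + r^-1)).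
Proof.
move=> d0; right; exists r => //=.
have hornerE' t : (jacobi_den polyC s g o1 o2 'X).[t] =
    jacobi_den (idfun : {rmorphism R -> R}) s g o1 o2 t.
  rewrite -[in RHS](hornerX t).
  have := @jacobi_den_rmorph R _ _ polyC idfun (horner_eval t) s g o1 o2
    (fun x => hornerC x t) 'X.
  exact.
have p0 : jacobi_den polyC s g o1 o2 'X != 0 :> {poly R}.
  apply/eqP => /(congr1 (fun p : {poly R} => p.[0])); rewrite hornerE' horner0.
  rewrite /jacobi_den /jacobi_num /jacobi_A0 /jacobi_A1 /jacobi_A2 /=.
  rewrite expr0n /= !mulr0 mul0r !addr0 !subr0 => /eqP; apply/negP.
  by rewrite !mulf_neq0// gt_eqF.
rewrite -(polyrcf.roots_on_rootsR p0) in_itv/= rootE hornerE'.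
by rewrite d0.
Qed.

Let parameter_boundary (q : R[i]) (x : R) : q != 0 ->
  q + q^-1 = (2 * ((x - a) / w))%:C ->
  x%:C * q = (s%:C + g%:C * q) * (s%:C * q + g%:C).
Proof.
move=> q0 qE; apply/(spectral_parameter s_gt0 g_gt0) => //; rewrite qE.
rewrite -rmorphB/= -fmorphV/= -rmorphM/=; congr (_%:C).
by rewrite /w /a; field; rewrite !gt_eqF.
Qed.

Let coordinate (x : R) : x = s ^+ 2 + g ^+ 2 + s * g * (2 * ((x - a) / w)).
Proof. by rewrite /w /a; field; rewrite !gt_eqF. Qed.

(** Inside the interval the parameter [q] tends to the point [c - i y] of the
    unit circle, and [jacobi_boundary] gives the limit. Outside, it tends to a
    real number of the unit disc at which the Green function is real, so that
    the limit is 0. *)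
Lemma poisson_int_spectral_density x0 : ~ exceptional_points x0 ->
  forall c : R, 0 < c -> exists2 d : R, 0 < d &
    forall x e : R, `|x - x0| < d -> 0 < e < d ->
      `|fine (poisson_int m e x) - pi * spectral_density x0| < c.
Proof.
move=> Nx0; have x0w : x0 != a - w /\ x0 != a + w.
  by split; apply/eqP => h; apply: Nx0; left; [left|right].
pose c0 := (x0 - a) / w; case: x0w => xm xp.
have [c1|c1|c1] := ltgtP `|c0| 1.
- have c02 : 0 < 1 - c0 ^+ 2 by move: c1; rewrite ltr_norml => /andP[? ?]; nra.
  pose y := Num.sqrt (1 - c0 ^+ 2).
  have y0 : 0 < y by rewrite sqrtr_gt0.
  have cy : c0 ^+ 2 + y ^+ 2 = 1 by rewrite sqr_sqrtr ?ltW// addrC subrK.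
  have [q0 Vq qV] := unit_circle_inv cy.
  have [d0 dens0 ImG] := jacobi_boundary cy y0.
  have -> : pi * spectral_density x0 =
      complex.Im (- ((c0 -i* y) * num (c0 -i* y) / den (c0 -i* y))).
    rewrite ImG /spectral_density /edge_density -/c0 -/y.
    have : pi != 0 :> R by rewrite gt_eqF// pi_gt0.
    by move: pi => p p0; field; rewrite p0 gt_eqF.
  apply: (poisson_int_boundary s_gt0 g_gt0 m_poisson y0 q0).
  + exact: parameter_boundary.
  + exact: jacobi_continuous_dist.
  + by move=> q q1 Iq; exact: unit_circle_dist.
- have [r [r0 r1 rE]] := real_spectral_parameter c1.
  have d0 : jacobi_den (idfun : {rmorphism R -> R}) s g o1 o2 r != 0.
    apply/eqP => /in_exceptional; rewrite rE; rewrite -coordinate; exact: Nx0.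
  have rC0 : r%:C != 0 :> R[i] by rewrite (inj_eq (@complexI R)).
  have dC := @jacobi_den_rmorph R _ _ idfun iota iota s g o1 o2 (fun x => erefl) r.
  have nC := @jacobi_num_rmorph R _ _ idfun iota iota s g o1 o2 (fun x => erefl) r.
  have dC0 : den r%:C != 0 by rewrite -[den _]dC (inj_eq (@complexI R)).
  have -> : pi * spectral_density x0 =
      complex.Im (- (r%:C * num r%:C / den r%:C)).
    rewrite -[num _]nC -[den _]dC; set N := jacobi_num _ _ _ _ _ _.
    set D := jacobi_den _ _ _ _ _ _.
    have -> : - (r%:C * N%:C / D%:C) = (- (r * N / D))%:C :> R[i].
      by rewrite rmorphN/= fmorph_div/= rmorphM.
    rewrite /=.
    rewrite spectral_density_eq0 ?mulr0// => /andP[x1 x2].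
    move: c1; rewrite ltNge => /negP; apply.
    rewrite /c0 normrM normfV (gtr0_norm w_gt0) ler_pdivrMr// mul1r ler_norml.
    by apply/andP; split; lra.
  have L0 : 0 < `|r|^-1 - 1 by rewrite subr_gt0 invf_gt1 ?normr_gt0.
  apply: (poisson_int_boundary s_gt0 g_gt0 m_poisson L0 rC0).
  + apply: parameter_boundary => //.
    by rewrite -fmorphV/= -rmorphD/= rE.
  + exact: jacobi_continuous_dist.
  + by move=> q q1 Iq; exact: real_dist.
- have : `|x0 - a| = w.
    move: c1; rewrite /c0 normrM normfV (gtr0_norm w_gt0) => /divr1_eq.
    exact.
  move=> h; have [h1|h1] := ger0P (x0 - a); rewrite ?(ger0_norm h1) ?(ltr0_norm h1) in h.
    by move: xp => /eqP; case; rewrite -h; ring.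
  by move: xm => /eqP; case; rewrite -h; ring.
Qed.

(** The singular part is the restriction of the measure to the finite set of
    exceptional points; off this closed set Stieltjes inversion applies. *)
Lemma is_ac_density_spectral : is_ac_density m spectral_density.
Proof.
split; [exact: measurable_spectral_density|exact: spectral_density_ge0|].
have fF := finite_exceptional_points.
have cF : closed exceptional_points.
  apply: (accessible_finite_set_closed (T := R)).1 fF.
  exact/hausdorff_accessible/norm_hausdorff.
have mF : measurable exceptional_points by exact: closed_measurable.
have lF : leb exceptional_points = 0%E.
  by apply: countable_lebesgue_measure0; exact: finite_set_countable.
exists (mrestr m mF); split.
  exists exceptional_points; split => //.
  change (m (~` exceptional_points `&` exceptional_points) = 0%E).
  by rewrite setICl measure0.
move=> B mB; have mBF : measurable (B `\` exceptional_points) by exact: measurableD.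
transitivity (m (B `\` exceptional_points) + m (B `&` exceptional_points))%E.
  rewrite -measureU//; first by rewrite setUC setUIDK.
  - exact: measurableI.
  - by rewrite setDE setIACA setICl setI0.
congr (_ + _)%E.
have mf A : measurable_fun A (EFin \o spectral_density).
  apply/measurable_EFinP; apply: measurable_funTS.
  exact: measurable_spectral_density.
rewrite (stieltjes_inversion (closed_openC cF) spectral_density_ge0
  measurable_spectral_density poisson_int_spectral_density)//.
rewrite -[in RHS](setUIDK B exceptional_points) ge0_integral_setU//.
- rewrite [X in _ = (X + _)%E](_ : _ = 0%E) ?add0e//.
  apply: null_set_integral => //; first exact: measurableI.
  exact: mf.
  apply/eqP; rewrite eq_le measure_ge0 andbT -[leRHS]lF.
  by apply: le_measure; rewrite ?inE//; exact: measurableI.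
- exact: measurableI.
- exact: mf.
- by move=> x _; rewrite lee_fin spectral_density_ge0.
- by apply/disj_setPS => x [[_ xF] [_ nxF]].
Qed.

End spectral_density.

(** * The parameters of the quantum walk *)

Section quantum_walk_parameters.
Context (R : realType) (r lam : R).
Hypotheses (hr : 0 < r < 1) (lam_gt0 : 0 < lam).
Local Notation t := (qw_t r).
Local Notation e := (1 - qw_t r).
Local Notation s := (Num.sqrt lam).
Local Notation g := (r / 2).

Lemma qw_t_bounds : 0 < t < 1.
Proof.
move: hr => /andP[r0 r1]; have h : 0 < 1 - r ^+ 2 by nra.
rewrite /qw_t sqrtr_gt0 h /= -[ltRHS]sqrtr1 ltr_sqrt//.
by rewrite gtrBl exprn_gt0.
Qed.

Lemma qw_t_sqr : t ^+ 2 = 1 - r ^+ 2.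
Proof. by move: hr => /andP[r0 r1]; rewrite sqr_sqrtr//; nra. Qed.

Lemma qw_g2 : g ^+ 2 = e * (2 - e) / 4.
Proof.
have -> : e * (2 - e) = 1 - t ^+ 2 by ring.
by rewrite qw_t_sqr; field.
Qed.

Lemma sqrt_qw_w : Num.sqrt (qw_w r) = g.
Proof.
have -> : qw_w r = g ^+ 2 by rewrite /qw_w; field.
by rewrite sqrtr_sqr ger0_norm// divr_ge0//; case/andP: hr => /ltW.
Qed.

Lemma qw_edges : qw_Sminus r lam = s ^+ 2 + g ^+ 2 - 2 * (s * g) /\
  qw_Splus r lam = s ^+ 2 + g ^+ 2 + 2 * (s * g).
Proof.
rewrite /qw_Sminus /qw_Splus sqrtrM ?(ltW lam_gt0)// sqrt_qw_w.
rewrite sqr_sqrtr ?(ltW lam_gt0)//.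
by have -> : qw_w r = g ^+ 2 by rewrite /qw_w; field.
Qed.

Lemma qw_transition_w : (lam == qw_w r) = (s == g).
Proof.
rewrite -sqrt_qw_w; apply/eqP/eqP => [->//|].
move=> h; have := congr1 (fun x => x ^+ 2) h; rewrite !sqr_sqrtr ?ltW//.
by rewrite /qw_w divr_gt0// exprn_gt0//; case/andP: hr.
Qed.

(** The value of the quartic at [-1] is affine in [s] with a positive slope, and
    [qw_Lambda] is the square of its zero. *)
Lemma qw_transition_Lambda : (lam == qw_Lambda r) =
  (qw_quartic s g e (idfun : {rmorphism R -> R}) (-1) == 0).
Proof.
have /andP[t0 t1] := qw_t_bounds; have /andP[r0 r1] := hr.
have k0 : 0 < t ^+ 2 - t + 2 by nra.
rewrite qw_quarticN1 /qw_Lambda.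
set l := r * e * (3 - t) / (4 * (t ^+ 2 - t + 2)).
have l0 : 0 < l.
  rewrite divr_gt0// ?mulr_gt0// ?subr_gt0//.
  by rewrite (lt_trans t1)// ltr1n.
have -> : s * (2 * g ^+ 2 + e ^+ 3 / 2) - g * (e ^+ 2 * (2 + e) / 4) =
    e / 2 * (t ^+ 2 - t + 2) * (s - l).
  by rewrite qw_g2 /l; field; rewrite gt_eqF.
have e0 : e != 0 by rewrite gt_eqF// subr_gt0.
rewrite mulf_eq0 mulf_eq0 (gt_eqF k0) orbF mulf_eq0 (negbTE e0) invr_eq0 pnatr_eq0/=.
rewrite subr_eq0; apply/eqP/eqP => [->|<-].
  by rewrite sqrtr_sqr ger0_norm// ltW.
by rewrite sqr_sqrtr// ltW.
Qed.

End quantum_walk_parameters.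

Theorem theorem1p4 (R : realType) (r : R) (H : hilbertType R)
    (Phi : nat -> H) (Bp Bm : {linear H -> H})
    (hr : 0 < r < 1)
    (hPhi : orthonormal_system Phi) (hPhi' : complete_system Phi)
    (hBp : is_qw_creation r Phi Bp) (hBm : is_qw_annihilation r Phi Bm) :
  forall (lam : R) (E : pvm H), 0 < lam ->
    is_spectral_measure E (qw_P Bp Bm lam) ->
    let mu := pvm_measure E (Phi 0%N) in
    let Sm := qw_Sminus r lam in
    let Sp := qw_Splus r lam in
    (exists f : R -> R, is_qw_density r lam mu f /\
       forall x : R, ~ (Sm <= x <= Sp) -> f x = 0) /\
    (forall f : R -> R, is_qw_density r lam mu f ->
      [/\ {in `]Sm, Sp[, forall x, derivable f x 1},
          derive1 f x @[x --> Sp^'-] --> -oo,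
          (lam = qw_Lambda r \/ lam = qw_w r) ->
            derive1 f x @[x --> Sm^'+] --> -oo,
          (lam <> qw_Lambda r /\ lam <> qw_w r) ->
            derive1 f x @[x --> Sm^'+] --> +oo &
          exists C : R, 0 < C /\
            f x / (C * (x - Sm) `^ qw_kappa r lam) @[x --> Sm^'+] --> (1 : R)]).
Proof.
move=> lam E lam0 EP mu Sm Sp.
have /andP[t0 t1] := qw_t_bounds hr; have /andP[r0 r1] := hr.
pose s := Num.sqrt lam; pose g := r / 2; pose e := 1 - qw_t r.
pose o1 := Num.sqrt (qw_omega r 1); pose o2 := Num.sqrt (qw_omega r 2).
have e0 : 0 < e by rewrite subr_gt0.
have e1 : e < 1 by rewrite /e; lra.
have s0 : 0 < s by rewrite sqrtr_gt0.
have g0 : 0 < g by rewrite divr_gt0.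
have om2 : 0 < qw_omega r 2 by rewrite /= mulr_gt0// divr_gt0.
have o10 : 0 < o1 by rewrite sqrtr_gt0.
have o20 : 0 < o2 by rewrite sqrtr_gt0.
have g2 : g ^+ 2 = e * (2 - e) / 4 := qw_g2 hr.
have o12 : o1 ^+ 2 = e by rewrite sqr_sqrtr// ltW.
have o22 : o2 ^+ 2 = e * (1 - e) / 2.
  by rewrite sqr_sqrtr ?ltW//= /e; field.
have [SmE SpE] := qw_edges hr lam0.
have m_poisson (q : R[i]) (x d : R) : 0 < d -> q != 0 -> `|q| < 1 ->
    (x +i* d) * q = (s%:C + g%:C * q) * (s%:C * q + g%:C) ->
    poisson_int mu d x = (complex.Im (- (q *
      jacobi_num (real_complex R) s g o1 o2 q /
      jacobi_den (real_complex R) s g o1 o2 q)))%:E.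
  have [cBp Bpn] := hBp; have [cBm Bm0 Bmn] := hBm.
  have omg j : Num.sqrt (qw_omega r j.+3) = g := sqrt_qw_w hr.
  move=> d0 q0 q1 zq.
  have [] // := poisson_int_jacobi hPhi s0 o10 o20 cBp cBm
    (Bpn 0%N) (Bpn 1%N) _ Bm0 (Bmn 0%N) (Bmn 1%N) _ EP d0 q0 q1 zq.
  - by move=> j; rewrite Bpn omg.
  - by move=> j; rewrite Bmn omg.
pose f0 := spectral_density s g o1 o2 e.
have f0E : is_ac_density mu f0 := is_ac_density_spectral s0 g0 o10 o20 g2 o12 o22 m_poisson.
pose a := s ^+ 2 + g ^+ 2; pose w := 2 * (s * g).
pose k := s ^+ 5 * g * o1 ^+ 2 * o2 ^+ 2 / pi.
pose p := qw_density_den s g e.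
have w0 : 0 < w by rewrite !mulr_gt0.
have k0 : 0 < k by rewrite divr_gt0 ?pi_gt0// !mulr_gt0 ?exprn_gt0.
have p0 c : -1 < c < 1 -> 0 < p.[c].
  exact: (qw_density_den_gt0 s0 g0 o10 o20 g2 o12 o22).
have SmE' : Sm = a - w := SmE.
have SpE' : Sp = a + w := SpE.
have f0_edge : {in `]a - w, a + w[, f0 =1 edge_density a w k p} by [].
have f0_continuous : {in `]a - w, a + w[, continuous f0}.
  move=> x xI; apply: differentiable_continuous; apply/derivable1_diffP.
  exact: (edge_derivable w0 p0 f0_edge).
split.
  exists f0; split; first by split => //; rewrite -/Sm -/Sp SmE' SpE'.
  by move=> x; rewrite SmE' SpE' => xI; exact: spectral_density_eq0.
move=> f [fE]; rewrite -/Sm -/Sp SmE' SpE' => f_continuous.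
have f_edge : {in `]a - w, a + w[, f =1 edge_density a w k p}.
  exact: (ae_eq_continuous (ac_density_ae_unique fE f0E)).
have pN1 : lam <> qw_Lambda r /\ lam <> qw_w r -> 0 < p.[-1].
  move=> [/eqP nL /eqP nw]; apply: qw_density_den_gt0_left => //.
    by rewrite -qw_transition_w.
  by rewrite -qw_transition_Lambda.
have p_root : lam = qw_Lambda r \/ lam = qw_w r ->
    exists p1 : {poly R}, (forall c, p.[c] = (1 + c) * p1.[c]) /\ 0 < p1.[-1].
  move=> h; apply: qw_density_den_root_left => //.
  case: h => /eqP h; [right|left]; apply/eqP.
    by rewrite -qw_transition_Lambda.
  by rewrite -qw_transition_w.
split.
- exact: (edge_derivable w0 p0 f_edge).
- by apply: (edge_derivative_right w0 k0 p0 f_edge); exact: qw_density_den_gt0_right.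
- by move=> /p_root[p1 [pE p10]]; exact: (edge_derivative_left_root w0 k0 p0 f_edge pE).
- by move=> /pN1; exact: (edge_derivative_left w0 k0 p0 f_edge).
rewrite /qw_kappa; case: ifPn => [/orP h|].
  have [|p1 [pE p10]] := p_root; first by case: h => /eqP; [left|right].
  exact: (edge_power_left_root w0 k0 p0 f_edge pE).
rewrite negb_or => /andP[/eqP nL /eqP nw].
exact: (edge_power_left w0 k0 p0 f_edge (pN1 (conj nL nw))).
Qed.
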